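(* If $p$ is an odd prime and $F$ is any 2-regular graph of order $p$, then there exists a 2-factorisation of $4K_p$ into $F$.
   Context: $\lambda K_n$ denotes the complete multigraph of order $n$ with exactly $\lambda$ distinct edges joining each pair of distinct vertices. A 2-factorisation of a (multi)graph into $F$ is a partition of its edge multiset into spanning subgraphs, each isomorphic to the 2-regular graph $F$. *)

(* Defs.v *)
From HB Require Import structures.
From mathcomp Require Import all_boot.

Set Implicit Arguments.
Unset Strict Implicit.
Unset Printing Implicit Defensive.

(* Finite loopless multigraphs: edges are objects of their own, so that
   parallel edges are distinct elements of [edge G]. *)
Record mgraph := MGraph {
  vert : finType;
  edge : finType;
  ends : edge -> {set vert};
  card_ends : forall e, #|ends e| = 2
}.

Arguments ends {m} e.

Definition graph_order (G : mgraph) : nat := #|vert G|.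

Definition simple_graph (G : mgraph) : Prop := injective (@ends G).

Definition degree (G : mgraph) (v : vert G) : nat :=
  #|[set e : edge G | v \in ends e]|.

Definition regular (k : nat) (G : mgraph) : Prop :=
  forall v : vert G, degree v = k.

Definition mgraph_iso (G H : mgraph) : Prop :=
  exists (f : vert G -> vert H) (g : edge G -> edge H),
    [/\ bijective f, bijective g &
        forall e : edge G, ends (g e) = f @: ends e].

Definition spanning_subgraph (G : mgraph) (B : {set edge G}) : mgraph :=
  @MGraph (vert G) {e : edge G | e \in B} (fun e => ends (val e))
          (fun e => card_ends (val e)).

(* lam K_n: the edges are the pairs (A, i) with A a 2-subset of the vertices
   and i < lam. *)
Definition complete_mgraph (lam n : nat) : mgraph :=
  @MGraph 'I_n ({A : {set 'I_n} | #|A| == 2} * 'I_lam)%type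
          (fun e => val e.1) (fun e => eqP (valP e.1)).

Definition factorisation_into (G F : mgraph) (P : {set {set edge G}}) : Prop :=
  partition P [set: edge G] /\
  forall B : {set edge G}, B \in P -> mgraph_iso (spanning_subgraph B) F.

(* Main.v *)
Require Import Defs.
From mathcomp Require Import all_boot all_order all_algebra zify.

(* Label the vertices by F_p.  Dilating by a = 1, ..., (p-1)/2 turns the
   circulant graph with connection set {1,2,3,4} into 4K_p, so it is enough to
   decompose this circulant into four copies of F.  Such a decomposition is cut
   out of the infinite strip on the integers with edges {i, i+d}, d <= 4: a
   "piece" places a few cycles of F simultaneously in the four copies, starting
   and ending at one and the same frontier shape, so that pieces can be
   concatenated and finally closed up modulo p.  The pieces are (3,3,3), (4,4)
   and (k) for k > 4, plus one exceptional piece absorbing the remaining 3- and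
   4-cycles.  Long cycles grow by four vertices at a time, as open paths
   extended at both ends.

   Some exceptional pieces, such as (3,3,4), only exist after exchanging the
   edges {0,x}, {0,-x}, {-y,y} of the circulant for {0,y}, {0,-y}, {-x,x}.  This
   is harmless since both triples have the same union of dilates. *)

Set Implicit Arguments.
Unset Strict Implicit.
Unset Printing Implicit Defensive.

Import GRing.Theory.

(** * Cycle decomposition of 2-regular graphs *)

Definition path_pairs (T : Type) (s : seq T) : seq (T * T) := zip s (behead s).

Definition cycle_pairs (T : Type) (c : seq T) : seq (T * T) := zip c (rot 1 c).

Definition edge_pairs (T : Type) (cs : seq (seq T)) : seq (T * T) :=
  flatten (map (@cycle_pairs T) cs).

Definition pair_set (T : finType) (x : T * T) : {set T} := [set x.1; x.2].

Lemma size_cycle_pairs (T : Type) (c : seq T) : size (cycle_pairs c) = size c.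
Proof. by rewrite size_zip size_rot minnn. Qed.

Lemma size_edge_pairs (T : Type) (cs : seq (seq T)) :
  size (edge_pairs cs) = size (flatten cs).
Proof.
rewrite !size_flatten /shape -map_comp; congr sumn.
by apply: eq_map => c; apply: size_cycle_pairs.
Qed.

Lemma cycle_pairs_map (T U : Type) (f : T -> U) (c : seq T) :
  cycle_pairs (map f c) = [seq (f x.1, f x.2) | x <- cycle_pairs c].
Proof.
rewrite /cycle_pairs -map_rot.
by elim: c (rot 1 c) => [|x c IH] [|y d] //=; rewrite IH.
Qed.

Lemma edge_pairs_map (T U : Type) (f : T -> U) (cs : seq (seq T)) :
  edge_pairs (map (map f) cs) = [seq (f x.1, f x.2) | x <- edge_pairs cs].
Proof.
rewrite /edge_pairs map_flatten -!map_comp; congr flatten.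
by apply: eq_map => c; apply: cycle_pairs_map.
Qed.

Lemma cycle_pairs_rot (T : eqType) n (c : seq T) :
  cycle_pairs (rot n c) =i cycle_pairs c.
Proof.
have rot_zip (s t : seq T) : size s = size t ->
    zip (rot n s) (rot n t) = rot n (zip s t).
  move=> st; rewrite /rot zip_cat ?size_drop ?st //; congr (_ ++ _).
    by elim: n s t {st} => [|k IH] [|x s] [|y t] //=; case: drop.
  by elim: n s t {st} => [|k IH] [|x s] [|y t] //=; rewrite IH.
move=> x; rewrite /cycle_pairs rot_rot rot_zip ?size_rot //.
by rewrite mem_rot.
Qed.

Section TwoRegularRelation.

Variables (T : finType) (e : rel T).
Hypothesis e_sym : symmetric e.
Hypothesis e_irr : irreflexive e.
Hypothesis e_deg : forall u, #|[set v | e u v]| = 2.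

Lemma nbr_two u y z v : y != z -> e u y -> e u z -> e u v -> v = y \/ v = z.
Proof.
move=> yz uy uz uv; have [->|vy] := eqVneq v y; first by left.
have [->|vz] := eqVneq v z; first by right.
have: uniq [:: v; y; z] by rewrite /= !inE negb_or vy vz yz.
move/card_uniqP => card3.
have: #|[:: v; y; z]| <= #|[set v | e u v]|.
  by apply/subset_leq_card/subsetP => w; rewrite !inE => /or3P[] /eqP ->.
by rewrite card3 e_deg.
Qed.

Lemma nbr_exists u y : exists2 z, z != y & e u z.
Proof.
have: 0 < #|[set v | e u v] :\ y|.
  have := cardsD1 y [set v | e u v]; rewrite e_deg; case: (_ \in _); lia.
by case/card_gt0P => z; rewrite !inE => /andP[zy uz]; exists z.
Qed.

(** A path from [v] of maximal length works: a neighbour of its end off the path could be appended.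
    Lengths are bounded by the number of vertices. *)
Lemma longest_path v :
  exists s, [/\ path e v s, uniq (v :: s) &
    forall w, e (last v s) w -> w \in v :: s].
Proof.
pose P n := [exists s : n.-tuple T, path e v s && uniq (v :: s)].
have P0 : exists n, P n by exists 0; apply/existsP; exists [tuple].
have Pb n : P n -> n <= #|T|.
  case/existsP => s /andP[_ us].
  have /card_uniqP us' : uniq s by case/andP: us.
  by rewrite -(size_tuple s) -us' max_card.
case: (ex_maxnP P0 Pb) => n /existsP[s /andP[ps us]] nmax.
exists s; split=> // w lw; apply/negPn/negP => ws.
suff: P n.+1 by move/nmax; rewrite ltnn.
apply/existsP; exists [tuple of rcons s w].
by rewrite rcons_path ps lw -rcons_cons rcons_uniq ws us.
Qed.

Lemma cycle_through v :
  exists c, [/\ v \in c, uniq c, cycle e c & 2 < size c].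
Proof.
have [s [ps us maxs]] := longest_path v; exists (v :: s).
pose m := last v s.
(* A neighbour of the last vertex lies on the path; unless it is the start or
   the penultimate vertex it would have three neighbours. *)
have back y : e m y -> y = v \/ exists s1, s = rcons (rcons s1 y) m.
  move=> my; have := maxs _ my; rewrite inE => /orP[/eqP|ys]; first by left.
  right; case/splitPr: ys ps us @m my {maxs} => s1 s2.
  rewrite cat_path /= => /and3P[p1 ly p2].
  case: s2 p2 => [|y' s2] /=.
    by rewrite last_cat /= e_irr.
  move=> /andP[yy' p2]; rewrite last_cat /= => us my.
  have un : uniq (rcons (v :: s1) y ++ y' :: s2) by rewrite cat_rcons.
  have [sep uys] : (forall w, w \in y' :: s2 -> w != last v s1) /\
                   uniq (y' :: s2).
    move: un; rewrite cat_uniq => /and3P[_ /hasPn h ->]; split=> // w /h.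
    apply: contra => /eqP ->.
    by rewrite mem_rcons inE mem_last orbT.
  have lm := sep _ (mem_last y' s2).
  have ly' : last v s1 != y' by rewrite eq_sym sep ?mem_head.
  have ey : e y (last v s1) by rewrite e_sym.
  have em : e y (last y' s2) by rewrite e_sym.
  have [E|E] := nbr_two ly' ey yy' em; first by rewrite E eqxx in lm.
  exists s1; rewrite E; case: s2 E uys {em lm sep un my us p2} => [|z s3] /= E.
    by rewrite -!cats1 -!catA.
  by rewrite -[X in X \notin _]E mem_last.
(* Of the two neighbours of the end [m], [z] is not [v] and so is penultimate; the other one, [w],
   is then [v], which closes the path. *)
have [z zv mz] := nbr_exists m v.
have [E|[s1 sE]] := back _ mz; first by rewrite E eqxx in zv.
have [w wz mw] := nbr_exists m z.
have wv : w = v.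
  case: (back _ mw) => // -[s2]; rewrite {1}sE => /rcons_inj[] /rcons_inj[_] E.
  by rewrite E eqxx in wz.
rewrite wv in mw.
split=> //; first exact: mem_head.
  by rewrite /= rcons_path ps.
by rewrite sE /= !size_rcons.
Qed.

(** Rotate [c] to start at [u]: its second and last vertices are two distinct neighbours of [u], and
    there is no third. *)
Lemma cycle_nbr c u v : uniq c -> cycle e c -> 2 < size c -> u \in c ->
  e u v -> (u, v) \in cycle_pairs c \/ (v, u) \in cycle_pairs c.
Proof.
move=> uc cc sc uc' uv; case: (rot_to uc') => i c' ci.
have /andP[unotin uc2] : uniq (u :: c') by rewrite -ci rot_uniq.
have pc : path e u (rcons c' u) by have := rot_cycle i e c; rewrite ci cc.
have sc' : size c' = (size c).-1 by rewrite -(size_rot i c) ci.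
rewrite -!(cycle_pairs_rot i c) {}ci.
case/lastP: c' => [|c' z] in unotin uc2 pc sc' *; first by move: sc sc' => /=; lia.
case: c' => [|y c'] in unotin uc2 pc sc' *; first by move: sc sc' => /=; lia.
move: pc; rewrite rcons_path last_rcons /= => /andP[/andP[uy _] zu].
have yz : y != z.
  by move: uc2 => /= /andP[]; rewrite mem_rcons inE negb_or => /andP[].
have uz : e u z by rewrite e_sym.
have -> : cycle_pairs (u :: rcons (y :: c') z) =
    rcons (zip (u :: y :: c') (y :: rcons c' z)) (z, u).
  by rewrite /cycle_pairs rot1_cons -zip_rcons //= size_rcons.
have [->|->] := nbr_two yz uy uz uv; [left|right].
  by rewrite mem_rcons !inE eqxx orbT.
by rewrite mem_rcons mem_head.
Qed.

Lemma cycle_cover : exists cs : seq (seq T),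
  [/\ uniq (flatten cs), forall v, v \in flatten cs,
      all (fun c => 2 < size c) cs &
      forall u v, e u v ->
        (u, v) \in edge_pairs cs \/ (v, u) \in edge_pairs cs].
Proof.
(* Induction over sets closed under adjacency: no edge leaves a cycle, so deleting the vertices of
   one cycle leaves a set of the same kind. *)
suff H n (A : {set T}) : #|A| <= n ->
    (forall u v, e u v -> u \in A -> v \in A) ->
    exists cs : seq (seq T),
      [/\ uniq (flatten cs), flatten cs =i A, all (fun c => 2 < size c) cs &
        forall u v, u \in A -> e u v ->
          (u, v) \in edge_pairs cs \/ (v, u) \in edge_pairs cs].
  have [|cs [? mem_cs ? cov]] := H _ setT (leqnn _); first by move=> *; rewrite inE.
  exists cs; split=> //; first by move=> v; rewrite mem_cs inE.
  by move=> u v; apply: cov; rewrite inE.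
elim: n A => [|n IH] A cardA clA.
  move: cardA; rewrite leqn0 cards_eq0 => /eqP ->.
  by exists [::]; split=> // [v|u v]; rewrite ?inE.
have [->|[v vA]] := set_0Vmem A.
  by exists [::]; split=> // [v|u v]; rewrite ?inE.
have [c [vc uc cc sc]] := cycle_through v.
have cA : {subset c <= A}.
  case: (rot_to vc) => i c' ci w; rewrite -(mem_rot i) ci.
  have: path e v c'.
    by have := rot_cycle i e c; rewrite ci cc /= rcons_path => /andP[].
  elim: c' {ci} v vA {vc} => [|x c' IHc] v vA /=; first by rewrite inE => _ /eqP->.
  move=> /andP[vx px]; rewrite inE => /orP[/eqP-> //|].
  by apply: IHc => //; apply: clA vA.
have cl_c u w : e u w -> w \in c -> u \in c.
  move=> uw wc; rewrite e_sym in uw.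
  have mem_pair x : x \in cycle_pairs c -> x.1 \in c /\ x.2 \in c.
    rewrite -(mem_rot 1 c x.2) /cycle_pairs.
    elim: (c) (rot 1 c) => [|a s IHs] [|b t] //=.
    by rewrite !inE => /orP[/eqP -> /=|/IHs[-> ->]]; rewrite ?eqxx ?orbT.
  by case: (cycle_nbr uc cc sc wc uw) => /mem_pair[].
have [||cs [ucs mem_cs scs cov]] := IH (A :\: [set x in c]).
- rewrite -ltnS; apply: leq_trans cardA; apply/proper_card/properP.
  split; first exact: subsetDl.
  by exists v; rewrite // !inE vc.
- move=> u w uw; rewrite !inE => /andP[unc uA].
  by rewrite (clA _ _ uw uA) andbT; apply: contra unc; apply: cl_c.
exists (c :: cs); split=> /=.
- rewrite cat_uniq uc ucs andbT; apply/hasPn => x.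
  by rewrite mem_cs !inE => /andP[].
- move=> x; rewrite mem_cat mem_cs !inE; case: (boolP (x \in c)) => //= /cA ->.
  by [].
- by rewrite sc.
move=> u w uA uw; rewrite /edge_pairs /= !mem_cat.
case: (boolP (u \in c)) => [ucc|unc].
  by case: (cycle_nbr uc cc sc ucc uw) => ->; [left|right].
by case: (cov u w); rewrite ?inE ?unc // => ->; rewrite orbT; [left|right].
Qed.

End TwoRegularRelation.

(** Incidences are counted twice over, each edge and each vertex lying in two of them. *)
Lemma card_edge_regular2 (F : mgraph) : regular 2 F -> #|edge F| = #|vert F|.
Proof.
move=> reg; apply/eqP; rewrite -(eqn_pmul2r (ltn0Sn 1)) -!sum_nat_const.
apply/eqP; transitivity (\sum_(e : edge F) \sum_(v : vert F) (v \in ends e)).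
  by apply: eq_bigr => e _; rewrite -big_mkcond /= sum1_card card_ends.
rewrite exchange_big /=; apply: eq_bigr => v _.
by rewrite -big_mkcond /= sum1_card -(reg v) /degree cardsE.
Qed.

(** Every edge joins consecutive vertices of some cycle. Since there are as many consecutive pairs
    as vertices, hence as edges, this inclusion already forces equality without repetition. *)
Lemma two_regular_cycles (F : mgraph) : simple_graph F -> regular 2 F ->
  exists cs : seq (seq (vert F)),
    [/\ perm_eq (flatten cs) (enum (vert F)), all (fun c => 2 < size c) cs &
        perm_eq (map (@pair_set _) (edge_pairs cs))
                [seq ends e | e <- enum (edge F)]].
Proof.
move=> simF reg.
pose adj u v := [exists e : edge F, ends e == [set u; v]].
have adj_sym : symmetric adj.
  by move=> u v; apply: eq_existsb => e; rewrite setUC.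
have adj_irr : irreflexive adj.
  move=> u; apply/negbTE/existsPn => e; apply/eqP => E.
  by have := card_ends e; rewrite E setUid cards1.
have adj_deg u : #|[set v | adj u v]| = 2.
  have pair_inj : {in [set v | adj u v] &, injective (fun v => [set u; v])}.
    move=> v w; rewrite !inE => uv _ E; have: v \in [set u; w] by rewrite -E set22.
    by rewrite !inE => /orP[/eqP vu|/eqP //]; rewrite vu adj_irr in uv.
  rewrite -(card_in_imset pair_inj) -(reg u) /degree -(card_imset _ simF).
  apply: eq_card => A; apply/imsetP/imsetP => [[v]|[e]]; rewrite inE.
    by move=> /existsP[e /eqP E] ->; exists e; rewrite ?E // inE E set21.
  move=> ue ->; have := card_ends e; rewrite (cardsD1 u) ue => -[/eqP/cards1P[v E]].
  exists v; last by rewrite -(setD1K ue) E.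
  by rewrite inE; apply/existsP; exists e; rewrite -(setD1K ue) E.
have [cs [ucs mem_cs size_cs cov]] := cycle_cover adj_sym adj_irr adj_deg.
have perm_cs : perm_eq (flatten cs) (enum (vert F)).
  by apply: uniq_perm => // [|v]; rewrite ?enum_uniq // mem_cs mem_enum.
exists cs; split=> //.
have uends : uniq [seq ends e | e <- enum (edge F)].
  by rewrite map_inj_uniq ?enum_uniq.
have sub : {subset [seq ends e | e <- enum (edge F)]
              <= map (@pair_set _) (edge_pairs cs)}.
  move=> _ /mapP[e _ ->]; have /eqP/cards2P[u [v [_ E]]] := card_ends e.
  have uv : adj u v by apply/existsP; exists e; rewrite E.
  rewrite E; case: (cov _ _ uv) => /(map_f (@pair_set _)) //.
  by rewrite /pair_set /= setUC.
have sizeE : size (map (@pair_set _) (edge_pairs cs))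
             = size [seq ends e | e <- enum (edge F)].
  rewrite size_map size_edge_pairs (perm_size perm_cs) [RHS]size_map.
  by rewrite -!cardE (card_edge_regular2 reg).
rewrite perm_sym; apply: uniq_perm => //.
  by apply: leq_size_uniq uends sub _; rewrite sizeE.
by have [] := uniq_min_size uends sub; rewrite ?sizeE.
Qed.

(** * From labelled copies of F to factorisations *)

(** Each labelling places a copy of [F]. As a pair [A] lies in exactly [lam] copies, its [lam]
    parallel edges can be dealt out to them bijectively. *)
Lemma factorisation_of_labellings (lam n : nat) (F : mgraph) (J : finType)
    (phi : J -> vert F -> 'I_n) :
  simple_graph F -> (forall j, bijective (phi j)) ->
  (forall A : {set 'I_n}, #|A| = 2 ->
     #|[set j | [exists e : edge F, phi j @: ends e == A]]| = lam) ->
  exists P : {set {set edge (complete_mgraph lam n)}}, factorisation_into F P.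
Proof.
move=> simF phi_bij cardJ.
pose S (A : {set 'I_n}) := [set j | [exists e : edge F, phi j @: ends e == A]].
have SE (A : {A : {set 'I_n} | #|A| == 2}) : #|S (val A)| = lam.
  by apply: cardJ; apply/eqP/(valP A).
(* The edge [(A, i)] goes to the [i]-th labelling covering [A]; the factors are the nonempty fibres
   of [h]. *)
pose h (x : edge (complete_mgraph lam n)) : J :=
  enum_val (cast_ord (esym (SE x.1)) x.2).
have hS x : h x \in S (val x.1) by apply: enum_valP.
have h_inj A : injective (fun i => h (A, i)).
  by move=> i k /enum_val_inj /cast_ord_inj.
have h_surj A j : j \in S (val A) -> exists i, h (A, i) = j.
  move=> jS; exists (cast_ord (SE A) (enum_rank_in jS j)).
  by rewrite /h /= cast_ordK enum_rankK_in.
exists (preim_partition h setT); split; first exact: preim_partitionP.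
move=> B /imsetP[x0 _ BE].
have memB x : (x \in B) = (h x0 == h x) by rewrite BE !inE.
set j := h x0 in memB.
have [f fK Kf] := phi_bij j.
pose W := edge (spanning_subgraph B).
have Wpair (w : W) : exists e : edge F, phi j @: ends e == val (val w).1.
  have := hS (val w); have := valP w; rewrite memB => /eqP <-.
  by rewrite inE => /existsP.
pose g w := xchoose (Wpair w).
have gE w : phi j @: ends (g w) = val (val w).1 by apply/eqP/(xchooseP (Wpair w)).
have g_inj : injective g.
  move=> w1 w2 E; apply: val_inj; have E1 : (val w1).1 = (val w2).1.
    by apply: val_inj; rewrite -!gE E.
  have := valP w1; have := valP w2; rewrite !memB => /eqP + /eqP.
  rewrite [val w1]surjective_pairing [val w2]surjective_pairing E1 => -> E2.
  by rewrite (h_inj _ _ _ E2).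
have g_surj e : exists w, g w == e.
  have cA : #|phi j @: ends e| == 2 by rewrite card_imset ?card_ends //; apply: can_inj fK.
  pose A : {A : {set 'I_n} | #|A| == 2} :=
    exist (fun A : {set 'I_n} => #|A| == 2) (phi j @: ends e) cA.
  have [|i hi] := h_surj A j; first by rewrite inE; apply/existsP; exists e.
  have wB : (A, i) \in B by rewrite memB hi.
  exists (exist (fun x => x \in B) (A, i) wB : W); apply/eqP/simF/(imset_inj (can_inj fK)).
  by rewrite gE.
exists f, g; split.
- by exists (phi j).
- exists (fun e => xchoose (g_surj e)) => w; last exact/eqP/(xchooseP (g_surj w)).
  by apply/g_inj/eqP/(xchooseP (g_surj (g w))).
move=> w; rewrite /= -gE -imset_comp -[LHS]imset_id.
by apply: eq_imset => v; rewrite /= fK.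
Qed.

(** With [f] the size function, a rearrangement of the cycle lengths is realised by one of the
    cycles. *)
Lemma perm_map_lift (T U : eqType) (f : T -> U) (s : seq T) (t : seq U) :
  perm_eq t (map f s) -> exists2 s', perm_eq s' s & map f s' = t.
Proof.
case: s => [|x s]; first by move/perm_nilP ->; exists [::].
set s0 := x :: s => /(perm_iotaP (f x))[I perm_I tE].
exists (map (nth x s0) I).
  by apply/(perm_iotaP x); exists (I) => //; rewrite size_map in perm_I.
rewrite tE -map_comp; apply/eq_in_map => i iI; rewrite [RHS](nth_map x) //.
by move: iI; rewrite (perm_mem perm_I) mem_iota size_map.
Qed.

(** * Dilations of F_p *)

Section HalfSystem.

Variable p : nat.
Hypotheses (p_pr : prime p) (p_odd : odd p).
Local Open Scope ring_scope.

(** For [j < p.-1./2] these multipliers represent the nonzero residues up to sign; the shift by one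
    skips 0. *)
Definition half_mult (j : nat) : 'F_p := (j.+1)%:R.

(** This is the weight an edge [x] of the base copies contributes to the multiplicity of [A] among
    all dilated copies; the total has to be 4 for each [A]. *)
Definition orbit_count (A : {set 'F_p}) (x : 'F_p * 'F_p) : nat :=
  (\sum_(j < p.-1./2)
     (pair_set (half_mult j * x.1, half_mult j * x.2)%R == A))%N.

Lemma Fp_natp : p%:R = 0 :> 'F_p.
Proof. by have := pcharf0 (pchar_Fp p_pr). Qed.

Lemma Fp_nat_eq0 (k : nat) : (k%:R == 0 :> 'F_p) = (p %| k)%N.
Proof. by rewrite -(dvdn_pcharf (pchar_Fp p_pr)). Qed.

Lemma sum_Fp (h : 'F_p -> nat) :
  (\sum_(c : 'F_p) h c = \sum_(0 <= k < p) h k%:R)%N.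
Proof.
transitivity (\sum_(0 <= k < (Zp_trunc (pdiv p)).+2) h k%:R)%N.
  by rewrite big_mkord; apply: eq_bigr => c _; rewrite natr_Zp.
by congr (\sum_(0 <= k < _) _)%N; apply: Fp_cast.
Qed.

Lemma sum_half_system (g : 'F_p -> nat) (x : 'F_p) : x != 0 ->
  (\sum_(j < p.-1./2) (g (half_mult j * x)%R + g (- (half_mult j * x))%R)
   = \sum_(c : 'F_p | c != 0%R) g c)%N.
Proof.
move=> x0; pose m := p.-1./2.
have pE : p = (m + m).+1.
  by have := prime_gt0 p_pr; have := odd_double_half p.-1; rewrite /m; lia.
have -> : (\sum_(c : 'F_p | c != 0%R) g c
           = \sum_(c : 'F_p | c != 0%R) g (c * x)%R)%N.
  rewrite (reindex_onto (fun c => c * x) (fun c => c / x)) /=; last first.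
    by move=> c _; rewrite mulfVK.
  apply: eq_bigl => c; rewrite mulf_eq0 (negbTE x0) orbF mulfK // eqxx.
  by rewrite andbT.
have := sum_Fp (fun c => g (c * x)); rewrite (bigD1 0) //= => E.
have {E}-> : (\sum_(c : 'F_p | c != 0%R) g (c * x)%R
            = \sum_(0 <= k < m + m) g (k.+1%:R * x)%R)%N.
  apply: (@addnI (g (0 * x)%R)); rewrite E.
  transitivity (\sum_(0 <= k < (m + m).+1) g (k%:R * x)%R)%N.
    by congr (\sum_(0 <= k < _) _)%N.
  by rewrite big_nat_recl.
rewrite big_mkord big_split_ord big_split /=; congr (_ + _)%N.
(* Read backwards, the residues above [m] are the negatives of those from 1 to [m]: the two entries
   with index [j] add up to [p]. *)
rewrite [RHS](reindex_inj rev_ord_inj) /=.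
apply: eq_bigr => j _; congr g; rewrite -mulNr; congr (_ * _).
apply/eqP; rewrite eq_sym -addr_eq0 /half_mult -natrD Fp_nat_eq0.
have jm : (j < m)%N := ltn_ord j.
have -> : ((m + (m - j.+1)).+1 + j.+1 = p)%N by rewrite [RHS]pE; lia.
exact: dvdnn.
Qed.

Lemma sum_half_even (g : 'F_p -> nat) (x : 'F_p) : x != 0 ->
  (forall c, g (- c) = g c) ->
  ((\sum_(j < p.-1./2) g (half_mult j * x)%R).*2
   = \sum_(c : 'F_p | c != 0%R) g c)%N.
Proof.
move=> x0 g_even; rewrite -(sum_half_system g x0) -addnn -big_split /=.
by apply: eq_bigr => j _; rewrite g_even.
Qed.

Lemma half_mult_neq0 j : (j < p.-1./2)%N -> half_mult j != 0.
Proof.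
move=> jm; rewrite Fp_nat_eq0 gtnNdvd //.
by have := odd_double_half p.-1; lia.
Qed.

Lemma orbit_count_sym A x y : orbit_count A (x, y) = orbit_count A (y, x).
Proof. by apply: eq_bigr => j _; rewrite /pair_set /= setUC. Qed.

Lemma circulant_orbit_count (A : {set 'F_p}) (d : 'F_p) : d != 0 ->
  #|A| = 2 -> (\sum_(i : 'F_p) orbit_count A (i, i + d)%R = 1)%N.
Proof.
move=> d0 cardA.
(* Dilating by [half_mult j] turns difference [d] into [half_mult j * d]. As [G] is even, twice the
   sum over the half system is the sum over all nonzero differences. *)
pose G c := (\sum_(i : 'F_p) (pair_set (i, i + c)%R == A))%N.
have G_even c : G (- c) = G c.
  rewrite /G (reindex_inj (addIr c)) /=; apply: eq_bigr => i _.
  by rewrite /pair_set /= addrK setUC.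
apply: double_inj.
have -> : (\sum_(i : 'F_p) orbit_count A (i, i + d)%R
           = \sum_(j < p.-1./2) G (half_mult j * d)%R)%N.
  rewrite exchange_big /=; apply: eq_bigr => j _.
  rewrite /G [RHS](reindex_inj (mulfI (half_mult_neq0 (ltn_ord j)))) /=.
  by apply: eq_bigr => i _; rewrite /= mulrDr.
rewrite sum_half_even // /G.
have /eqP/cards2P[u [v [uv ->]]] := cardA.
(* Only [u] and [v] can serve as the base point [i], each with a single difference, so the doubled
   count is 2. *)
rewrite exchange_big (bigD1 u) //= [X in (_ + X)%N](bigD1 v) 1?eq_sym //= addnA.
rewrite [X in (_ + X)%N]big1 ?addn0; last first.
  move=> i /andP[iu iv]; rewrite big1 // => c _; apply/eqP.
  rewrite eqb0; apply/eqP => E.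
  have: i \in pair_set (i, i + c) by apply: set21.
  by rewrite E !inE (negbTE iu) (negbTE iv).
have one (a b : 'F_p) : a != b ->
    (\sum_(c : 'F_p | c != 0%R) (pair_set (a, a + c)%R == [set a; b]) = 1)%N.
  move=> ab; rewrite (bigD1 (b - a)) /=; last by rewrite subr_eq0 eq_sym.
  rewrite /pair_set /= addrCA subrr addr0 eqxx big1 // => c /andP[c0 cba].
  apply/eqP; rewrite eqb0; apply/eqP => E.
  have: a + c \in [set a; b] by rewrite -E set22.
  rewrite !inE => /orP[|/eqP E2]; first by rewrite -subr_eq0 addrAC subrr add0r (negbTE c0).
  by rewrite -E2 addrAC subrr add0r eqxx in cba.
by rewrite one // setUC one // eq_sym.
Qed.

(* All the pairs {0, +-a x} run once over the pairs {0, c}, and the pairs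
   {-a y, a y} once over the pairs {-c, c}, whatever the nonzero x and y. *)
Lemma central_swap_orbit_count (A : {set 'F_p}) (x y : 'F_p) :
  x != 0 -> y != 0 ->
  (orbit_count A (0, x)%R + orbit_count A (- x, 0)%R
     + orbit_count A (- y, y)%R
   = orbit_count A (0, y)%R + orbit_count A (- y, 0)%R
     + orbit_count A (- x, x)%R)%N.
Proof.
move=> x0 y0.
have star z : z != 0 -> (orbit_count A (0, z)%R + orbit_count A (- z, 0)%R
    = \sum_(c : 'F_p | c != 0%R) (pair_set (0, c)%R == A))%N.
  move=> z0; rewrite -(sum_half_system _ z0) big_split /=; congr (_ + _)%N.
    by apply: eq_bigr => j _; rewrite /= mulr0.
  by apply: eq_bigr => j _; rewrite /= mulr0 mulrN /pair_set /= setUC.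
have diam z : z != 0 -> ((orbit_count A (- z, z)%R).*2
    = \sum_(c : 'F_p | c != 0%R) (pair_set (- c, c)%R == A))%N.
  move=> z0; rewrite -(sum_half_even z0); last first.
    by move=> c; rewrite /pair_set /= opprK setUC.
  by congr (_.*2); apply: eq_bigr => j _; rewrite /= mulrN.
by rewrite !star //; congr (_ + _)%N; apply: double_inj; rewrite !diam.
Qed.

End HalfSystem.

(** * Labelling the cycles of F by residues *)

Lemma sum_nat_inj_exists (T : finType) (U : eqType) (f : T -> U) (y : U) :
  injective f -> \sum_(x : T) (f x == y) = [exists x, f x == y].
Proof.
move=> f_inj; case: existsP => [[x /eqP <-]|no]; last first.
  by rewrite big1 // => x _; case: eqP => // E; case: no; exists x; apply/eqP.
by rewrite (bigD1 x) //= eqxx big1 // => z zx; rewrite (inj_eq f_inj) (negbTE zx).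
Qed.

Lemma labelling_of_cycles (T U : eqType) (cs : seq (seq T)) (L : seq (seq U)) (u0 : U) :
  uniq (flatten cs) -> uniq (flatten L) -> shape L = shape cs ->
  exists f : T -> U, map (map f) cs = L /\ {in flatten cs &, injective f}.
Proof.
(* Vertices and labels are matched by position; the default [u0] is reached only off the cycles. *)
move=> ucs uL sh; exists (fun v => nth u0 (flatten L) (index v (flatten cs))).
have sz : size (flatten cs) = size (flatten L) by rewrite !size_flatten sh.
split=> [|v w vcs wcs /eqP].
  set f := (fun v => _); have fE : map f (flatten cs) = flatten L.
    apply: (@eq_from_nth _ u0) => [|i]; rewrite size_map // => ics.
    case: (flatten cs) ics ucs @f => [|v0 s] // ics ucs f.
    by rewrite (nth_map v0) // /f index_uniq.
  apply: eq_from_flatten_shape; first by rewrite -map_flatten.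
  by rewrite sh /shape -map_comp; apply: eq_map => c; rewrite /= size_map.
rewrite nth_uniq -?sz ?index_mem // => /eqP /(congr1 (nth v (flatten cs))).
by rewrite !nth_index.
Qed.

Local Open Scope ring_scope.

Lemma labelled_factorisation (p : nat) (F : mgraph) (cs : seq (seq (vert F)))
    (L : 'I_4 -> seq (seq 'F_p)) :
  prime p -> odd p -> simple_graph F -> graph_order F = p ->
  perm_eq (flatten cs) (enum (vert F)) ->
  perm_eq (map (@pair_set _) (edge_pairs cs)) [seq ends e | e <- enum (edge F)] ->
  (forall t, shape (L t) = shape cs) -> (forall t, uniq (flatten (L t))) ->
  (forall A : {set 'F_p}, #|A| = 2 ->
     (\sum_(t < 4) \sum_(x <- edge_pairs (L t)) orbit_count A x = 4)%N) ->
  exists P : {set {set edge (complete_mgraph 4 p)}}, factorisation_into F P.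
Proof.
move=> p_pr p_odd simF ordF perm_cs perm_es shL uL count4.
have ucs : uniq (flatten cs) by rewrite (perm_uniq perm_cs) enum_uniq.
have mem_cs v : v \in flatten cs by rewrite (perm_mem perm_cs) mem_enum.
have labP t : exists f : {ffun vert F -> 'F_p},
    map (map f) cs == L t /\ injective f.
  have [f [fE finj]] := labelling_of_cycles 0 ucs (uL t) (shL t).
  exists [ffun v => f v]; split.
    by rewrite -fE; apply/eqP/eq_map => c; apply: eq_map => v; rewrite ffunE.
  by move=> v w; rewrite !ffunE; apply: finj.
have {labP}[lab labP] := fin_all_exists labP.
pose psi (x : 'F_p) : 'I_p := cast_ord (card_Fp p_pr) (enum_rank x).
have psi_inj : injective psi by move=> x y /cast_ord_inj /enum_rank_inj.
have psi_bij : bijective psi.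
  by apply: inj_card_bij psi_inj _; rewrite card_ord card_Fp.
(* One copy of [F] for each multiplier and each of the four base labellings. *)
pose phi (j : 'I_(p.-1./2) * 'I_4) v := psi (half_mult p j.1 * lab j.2 v).
have phi_inj j : injective (phi j).
  move=> v w /psi_inj /(mulfI (half_mult_neq0 p_pr p_odd (ltn_ord j.1))).
  by apply: (labP j.2).2.
apply: (@factorisation_of_labellings 4 p F _ phi simF).
  by move=> j; apply: inj_card_bij (phi_inj j) _; rewrite card_ord -ordF.
move=> A cardA; pose A' := psi @^-1: A.
have AE : psi @: A' = A.
  have [psi' psiK Kpsi] := psi_bij; apply/setP => y; apply/imsetP/idP.
    by case=> x; rewrite inE => ? ->.
  by move=> yA; exists (psi' y); rewrite ?inE Kpsi.
have cardA' : #|A'| = 2 by rewrite -(card_imset _ psi_inj) AE.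
apply: etrans (count4 _ cardA'); rewrite -sum1_card big_mkcond /=.
have -> : (\sum_(t < 4) \sum_(x <- edge_pairs (L t)) orbit_count A' x
    = \sum_(j < p.-1./2) \sum_(t < 4) \sum_(x <- edge_pairs (L t))
        (pair_set (half_mult p j * x.1, half_mult p j * x.2)%R == A'))%N.
  by rewrite exchange_big /=; apply: eq_bigr => t _; rewrite exchange_big.
rewrite pair_bigA /=; apply: eq_bigr => j _; rewrite inE.
have ends_inj : injective (fun e : edge F => phi j @: ends e).
  by move=> e e' /(imset_inj (phi_inj j)) /simF.
transitivity ([exists e : edge F, phi j @: ends e == A] : nat); first by case: ifP.
rewrite -(sum_nat_inj_exists _ ends_inj).
have [/eqP <- _] := labP j.2.
rewrite edge_pairs_map big_map -[LHS]big_enum /=.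
rewrite -(big_map (@ends F) predT (fun B => nat_of_bool (phi j @: B == A))).
rewrite -(perm_big _ perm_es) big_map; apply: eq_bigr => -[u v] _ /=.
by rewrite -AE -(inj_eq (imset_inj psi_inj)) /pair_set /= !imsetU1 !imset_set1.
Qed.

Local Close Scope ring_scope.

(** * Concatenating pieces of the strip *)

(** Sorting the ends makes undirected edges comparable as plain pairs. *)
Definition ordered_pair (x : nat * nat) := (minn x.1 x.2, maxn x.1 x.2).

Definition shift_pair n (x : nat * nat) := (n + x.1, n + x.2).

(** Edges are attributed to their lower end, so that strips of consecutive intervals simply add
    up. *)
Definition strip n : seq (nat * nat) :=
  [seq (i, i + d) | i <- iota 0 n, d <- iota 1 4].

Definition edge_seq (cs : seq (seq nat)) := map ordered_pair (edge_pairs cs).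

Definition path_seq (s : seq nat) := map ordered_pair (path_pairs s).

(* Testing against arbitrary weights [w] expresses equality of multisets.
   [B t] are the vertices already covered in copy [t] and [eb] the edges already
   consumed before the piece starts; [mi] are the edges of the strip missing
   from the piece and [ex] the ones it uses in addition. *)
Definition piece (B : nat -> seq nat) (eb mi ex : seq (nat * nat))
    (ks : seq nat) (L : nat -> seq (seq nat)) : Prop :=
  [/\ forall t, t < 4 -> shape (L t) = ks,
      forall t, t < 4 -> forall w : nat -> nat,
        \sum_(x <- B t) w x + \sum_(x <- flatten (L t)) w x
        = \sum_(x <- iota 0 (sumn ks)) w x + \sum_(x <- B t) w (sumn ks + x)
    & forall w : nat * nat -> nat,
        \sum_(x <- eb) w x + \sum_(x <- mi) w x
          + \sum_(0 <= t < 4) \sum_(x <- edge_seq (L t)) w x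
        = \sum_(x <- strip (sumn ks)) w x + \sum_(x <- ex) w x
          + \sum_(x <- eb) w (shift_pair (sumn ks) x)].

(** A boolean form of [piece], settled by computation on explicit lists. *)
Definition piece_check (B : nat -> seq nat) (eb mi ex : seq (nat * nat))
    (ks : seq nat) (L : seq (seq (seq nat))) : bool :=
  [&& all (fun t => shape (nth [::] L t) == ks) (iota 0 4),
      all (fun t => perm_eq (B t ++ flatten (nth [::] L t))
             (iota 0 (sumn ks) ++ map (addn (sumn ks)) (B t))) (iota 0 4)
    & perm_eq (eb ++ mi ++ flatten [seq edge_seq (nth [::] L t) | t <- iota 0 4])
        (strip (sumn ks) ++ ex ++ map (shift_pair (sumn ks)) eb)].

Lemma sum_iota_add n1 n2 (w : nat -> nat) :
  \sum_(x <- iota 0 (n1 + n2)) w x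
  = \sum_(x <- iota 0 n1) w x + \sum_(x <- iota 0 n2) w (n1 + x).
Proof.
rewrite iotaD big_cat; congr (_ + _).
by rewrite addnC iotaDl big_map.
Qed.

Lemma sum_strip n (w : nat * nat -> nat) :
  \sum_(x <- strip n) w x
  = \sum_(i <- iota 0 n) \sum_(d <- iota 1 4) w (i, i + d).
Proof. by rewrite big_allpairs_dep. Qed.

Lemma sum_strip_add n1 n2 (w : nat * nat -> nat) :
  \sum_(x <- strip (n1 + n2)) w x
  = \sum_(x <- strip n1) w x + \sum_(x <- strip n2) w (shift_pair n1 x).
Proof.
rewrite !sum_strip sum_iota_add; congr (_ + _); apply: eq_bigr => i _.
by apply: eq_bigr => d _; rewrite /shift_pair /= addnA.
Qed.

Lemma ordered_pair_shift n x :
  ordered_pair (shift_pair n x) = shift_pair n (ordered_pair x).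
Proof. by rewrite /ordered_pair /shift_pair /= addn_minr addn_maxr. Qed.

Lemma edge_seq_cat cs1 cs2 : edge_seq (cs1 ++ cs2) = edge_seq cs1 ++ edge_seq cs2.
Proof. by rewrite /edge_seq /edge_pairs map_cat flatten_cat map_cat. Qed.

Lemma edge_seq_shift n cs :
  edge_seq (map (map (addn n)) cs) = map (shift_pair n) (edge_seq cs).
Proof.
rewrite /edge_seq edge_pairs_map -!map_comp; apply: eq_map => x /=.
exact: ordered_pair_shift.
Qed.

Lemma sum_edge_seq_cat n (L1 L2 : nat -> seq (seq nat)) (w : nat * nat -> nat) :
  \sum_(0 <= t < 4) \sum_(x <- edge_seq (L1 t ++ map (map (addn n)) (L2 t))) w x
  = \sum_(0 <= t < 4) \sum_(x <- edge_seq (L1 t)) w x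
    + \sum_(0 <= t < 4) \sum_(x <- edge_seq (L2 t)) w (shift_pair n x).
Proof.
rewrite -big_split /=; apply: eq_bigr => t _.
by rewrite edge_seq_cat edge_seq_shift big_cat big_map.
Qed.

Lemma pieceP B eb mi ex ks L :
  piece_check B eb mi ex ks L -> piece B eb mi ex ks (nth [::] L).
Proof.
have lt4 t : t < 4 -> t \in iota 0 4 by rewrite mem_iota.
case/and3P => /allP sh /allP vs es; split=> [t /lt4/sh/eqP //|t /lt4/vs E w|w].
  by rewrite -big_cat (perm_big _ E) big_cat big_map.
transitivity (\sum_(x <- eb ++ mi ++ flatten
    [seq edge_seq (nth [::] L t) | t <- iota 0 4]) w x).
  by rewrite -addnA big_cat big_cat big_flatten big_map.
by rewrite -addnA (perm_big _ es) !big_cat big_map.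
Qed.

Lemma piece_nil B eb : piece B eb [::] [::] [::] (fun=> [::]).
Proof.
split=> // [t _ w|w]; first by rewrite /= !big_nil addnC.
rewrite [X in _ + X = _]big1 => [|t _]; last by rewrite big_nil.
by rewrite !big_nil !addn0; apply: eq_bigr => -[].
Qed.

(** Translated by [sumn ks1], the second piece begins at the frontier where the first ends. Adding
    the balances of both, the second for the translated weight, cancels that frontier. *)
Lemma piece_cat B eb mi ex ks1 ks2 L1 L2 :
  piece B eb mi ex ks1 L1 -> piece B eb [::] [::] ks2 L2 ->
  piece B eb mi ex (ks1 ++ ks2)
    (fun t => L1 t ++ map (map (addn (sumn ks1))) (L2 t)).
Proof.
move=> [sh1 vs1 es1] [sh2 vs2 es2]; split=> [t t4|t t4 w|w].
- rewrite /shape map_cat -!/(shape _) sh1 // -(sh2 t) // /shape -map_comp.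
  by congr (_ ++ _); apply: eq_map => c; rewrite /= size_map.
- rewrite sumn_cat flatten_cat big_cat /= -map_flatten big_map sum_iota_add.
  have := vs1 t t4 w; have := vs2 t t4 (fun x => w (sumn ks1 + x)) => /=.
  under [\sum_(x <- B t) w (sumn ks1 + sumn ks2 + x)]eq_bigr do rewrite -addnA.
  lia.
have := es1 w; have := es2 (fun x => w (shift_pair (sumn ks1) x)) => /=.
rewrite sum_edge_seq_cat sumn_cat sum_strip_add !big_nil.
have -> : \sum_(x <- eb) w (shift_pair (sumn ks1 + sumn ks2) x)
    = \sum_(x <- eb) w (shift_pair (sumn ks1) (shift_pair (sumn ks2) x)).
  by apply: eq_bigr => x _; rewrite /shift_pair /= !addnA.
lia.
Qed.

(* With the centre [z] placed at 0, exchanging these three edges for the ones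
   with [x] and [y] swapped does not change the union of the dilates. *)
Definition central_star x y z : seq (nat * nat) :=
  [:: (z, z + x); (z - x, z); (z - y, z + y)].

(** With [x = y] the exchange of star edges is void, so plain pieces fit the format of the
    exceptional ones. *)
Lemma piece_trivial_star B eb ks L :
  piece B eb [::] [::] ks L ->
  piece B eb (central_star 1 1 1) (central_star 1 1 1) ks L.
Proof. by move=> [sh vs es]; split=> // w; have := es w; rewrite !big_nil; lia. Qed.

Lemma sum_edge_pairs_sym (cs : seq (seq nat)) (w : nat * nat -> nat) :
  (forall x y, w (x, y) = w (y, x)) ->
  \sum_(x <- edge_seq cs) w x = \sum_(x <- edge_pairs cs) w x.
Proof.
move=> w_sym; rewrite big_map; apply: eq_bigr => -[x y] _.
rewrite /ordered_pair /=; case: (leqP x y) => //.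
Qed.

Local Open Scope ring_scope.

Lemma piece_factorisation (p : nat) (F : mgraph) (cs : seq (seq (vert F)))
    B eb x y z ks L :
  prime p -> (4 < p)%N -> simple_graph F -> graph_order F = p ->
  perm_eq (flatten cs) (enum (vert F)) ->
  perm_eq (map (@pair_set _) (edge_pairs cs)) [seq ends e | e <- enum (edge F)] ->
  shape cs = ks -> piece B eb (central_star x y z) (central_star y x z) ks L ->
  (0 < x < 5)%N -> (0 < y < 5)%N -> (x <= z)%N -> (y <= z)%N ->
  exists P : {set {set edge (complete_mgraph 4 p)}}, factorisation_into F P.
Proof.
move=> p_pr p4 simF ordF perm_cs perm_es shcs [shL vs es] x5 y5 xz yz.
have p_odd : odd p by have := even_prime p_pr; lia.
have small d : (0 < d < 5)%N -> d%:R != 0 :> 'F_p.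
  by move=> d5; rewrite (Fp_nat_eq0 p_pr) gtnNdvd //; lia.
have sum_ks : sumn ks = p.
  by rewrite -shcs -size_flatten (perm_size perm_cs) -cardE.
rewrite sum_ks in vs es.
(* Reduction modulo [p], translated so that the centre [z] of the star falls on 0. *)
pose s : 'F_p := - z%:R; pose f (i : nat) : 'F_p := i%:R + s.
have f_period i : f (p + i)%N = f i by rewrite /f natrD (Fp_natp p_pr) add0r.
have fD i d : f (i + d)%N = f i + d%:R by rewrite /f natrD addrAC.
have sum_f (h : 'F_p -> nat) : (\sum_(i <- iota 0 p) h (f i) = \sum_(c : 'F_p) h c)%N.
  rewrite [RHS](reindex_inj (addIr s)) (sum_Fp p_pr (fun c => h (c + s))).
  by rewrite /index_iota subn0.
pose L' (t : 'I_4) := map (map f) (L t).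
apply: (labelled_factorisation (L := L')) perm_cs perm_es _ _ _ => //.
- move=> t; rewrite shcs -(shL t) // /shape -map_comp.
  by apply: eq_map => c; rewrite /= size_map.
(* Take the indicator of residue [c] as weight: the frontier terms cancel since [f] has period [p],
   and [c] is hit once on [iota 0 p]. *)
- move=> t; suff one c : count_mem c (flatten (L' t)) = 1%N.
    apply: count_mem_uniq => c; rewrite one.
    by have := one c; rewrite -has_pred1 has_count => ->.
  rewrite -map_flatten -sum1_count big_map big_mkcond /=.
  have := vs t (ltn_ord t) (fun i => nat_of_bool (f i == c)).
  under [X in _ = (_ + X)%N -> _]eq_bigr do rewrite f_period.
  rewrite addnC => /addIn E.
  rewrite (eq_bigr (fun i => nat_of_bool (f i == c))); last by move=> i _; case: ifP.
  rewrite E (sum_f (fun d => nat_of_bool (d == c))) (bigD1 c) //= eqxx.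
  by rewrite big1 // => d /negbTE ->.
move=> A cardA; pose w (x : nat * nat) := orbit_count A (f x.1, f x.2).
have w_sym i j : w (i, j) = w (j, i) by apply: orbit_count_sym.
have := es w.
have -> : (\sum_(0 <= t < 4) \sum_(x <- edge_seq (L t)) w x
    = \sum_(t < 4) \sum_(x <- edge_pairs (L' t)) orbit_count A x)%N.
  rewrite big_mkord; apply: eq_bigr => t _.
  by rewrite sum_edge_pairs_sym // /L' edge_pairs_map big_map.
(* Each difference from 1 to 4 is nonzero modulo [p], and its translates and dilates meet [A]
   once. *)
have -> : (\sum_(x <- strip p) w x = 4)%N.
  rewrite sum_strip exchange_big; transitivity (\sum_(d <- iota 1 4) 1)%N.
    apply: eq_big_seq => d; rewrite mem_iota => d5.
    rewrite -[RHS](circulant_orbit_count p_pr p_odd (small d d5) cardA).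
    by rewrite -sum_f; apply: eq_bigr => i _; rewrite /w /= fD.
  by rewrite big_const_seq.
have -> : (\sum_(x <- eb) w (shift_pair p x) = \sum_(x <- eb) w x)%N.
  by apply: eq_bigr => -[i j] _; rewrite /w /= !f_period.
have fz : f z = 0 by rewrite /f subrr.
have fzB d : (d <= z)%N -> f (z - d)%N = - d%:R.
  by move=> dz; rewrite /f natrB // addrAC subrr add0r.
have := central_swap_orbit_count p_pr p_odd A (small x x5) (small y y5).
rewrite /central_star !big_cons !big_nil /w /= !fD !fzB // fz !add0r.
move: (\sum_(t < 4) _)%N (\sum_(i <- eb) _)%N (orbit_count A (0, x%:R))
  (orbit_count A (- x%:R, 0)) (orbit_count A (- x%:R, x%:R))
  (orbit_count A (0, y%:R)) (orbit_count A (- y%:R, 0))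
  (orbit_count A (- y%:R, y%:R)) => a b c1 c2 c3 c4 c5 c6.
clear; lia.
Qed.

Local Close Scope ring_scope.

(** * The pieces *)

(* The common frontier, found by computer search together with the pieces:
   [occupied t] are the vertices at or beyond the origin that the preceding
   pieces cover in copy [t], and [used] the edges starting there that they
   consume. *)
Definition occupied (t : nat) : seq nat :=
  nth [::] [:: [:: 0]; [:: 0; 1; 3]; [:: 1]; [:: 2]] t.

Definition used : seq (nat * nat) := [:: (1, 3)].

Lemma piece_3_3_3 : exists L,
  piece occupied used [::] [::] [:: 3; 3; 3] L.
Proof.
have := @pieceP occupied used [::] [::] [:: 3; 3; 3]
    [:: [:: [:: 1; 5; 2]; [:: 3; 7; 4]; [:: 6; 9; 8]]; [:: [:: 2; 6; 4]; [::
    5; 9; 7]; [:: 8; 12; 10]]; [:: [:: 0; 3; 2]; [:: 4; 8; 5]; [:: 6; 10;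
    7]]; [:: [:: 0; 4; 1]; [:: 3; 6; 5]; [:: 7; 11; 8]]] erefl.
by eexists; eassumption.
Qed.

Lemma piece_4_4 : exists L,
  piece occupied used [::] [::] [:: 4; 4] L.
Proof.
have := @pieceP occupied used [::] [::] [:: 4; 4]
    [:: [:: [:: 1; 4; 3; 2]; [:: 5; 8; 7; 6]]; [:: [:: 2; 6; 8; 4]; [:: 5; 9;
    11; 7]]; [:: [:: 0; 4; 5; 2]; [:: 3; 7; 9; 6]]; [:: [:: 0; 3; 5; 1]; [::
    4; 7; 10; 6]]] erefl.
by eexists; eassumption.
Qed.

Lemma piece_5 : exists L,
  piece occupied used [::] [::] [:: 5] L.
Proof.
have := @pieceP occupied used [::] [::] [:: 5]
    [:: [:: [:: 1; 5; 3; 4; 2]]; [:: [:: 2; 6; 8; 4; 5]]; [:: [:: 0; 4; 6; 3;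
    2]]; [:: [:: 0; 3; 7; 4; 1]]] erefl.
by eexists; eassumption.
Qed.

Lemma piece_6 : exists L,
  piece occupied used [::] [::] [:: 6] L.
Proof.
have := @pieceP occupied used [::] [::] [:: 6]
    [:: [:: [:: 1; 5; 6; 3; 4; 2]]; [:: [:: 2; 6; 4; 7; 9; 5]]; [:: [:: 0; 4;
    5; 7; 3; 2]]; [:: [:: 0; 3; 5; 8; 4; 1]]] erefl.
by eexists; eassumption.
Qed.

Lemma piece_3_5 : exists L,
  piece occupied used [::] [::] [:: 3; 5] L.
Proof.
have := @pieceP occupied used [::] [::] [:: 3; 5]
    [:: [:: [:: 1; 4; 2]; [:: 3; 6; 8; 7; 5]]; [:: [:: 7; 11; 9]; [:: 2; 6;
    4; 8; 5]]; [:: [:: 5; 9; 6]; [:: 0; 4; 7; 3; 2]]; [:: [:: 6; 10; 7]; [::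
    0; 3; 4; 5; 1]]] erefl.
by eexists; eassumption.
Qed.

Lemma piece_3_6 : exists L,
  piece occupied used [::] [::] [:: 3; 6] L.
Proof.
have := @pieceP occupied used [::] [::] [:: 3; 6]
    [:: [:: [:: 3; 7; 4]; [:: 1; 5; 9; 8; 6; 2]]; [:: [:: 8; 12; 10]; [:: 2;
    5; 7; 9; 6; 4]]; [:: [:: 6; 10; 7]; [:: 0; 4; 8; 5; 3; 2]]; [:: [:: 7;
    11; 8]; [:: 0; 3; 6; 5; 4; 1]]] erefl.
by eexists; eassumption.
Qed.

Lemma piece_3_3_5 : exists L,
  piece occupied used [::] [::] [:: 3; 3; 5] L.
Proof.
have := @pieceP occupied used [::] [::] [:: 3; 3; 5]
    [:: [:: [:: 3; 7; 4]; [:: 8; 11; 10]; [:: 1; 5; 9; 6; 2]]; [:: [:: 7; 11;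
    9]; [:: 10; 14; 12]; [:: 2; 5; 6; 8; 4]]; [:: [:: 6; 10; 7]; [:: 8; 12;
    9]; [:: 0; 4; 5; 3; 2]]; [:: [:: 5; 8; 7]; [:: 9; 13; 10]; [:: 0; 3; 6;
    4; 1]]] erefl.
by eexists; eassumption.
Qed.

Lemma piece_3_3_6 : exists L,
  piece occupied used [::] [::] [:: 3; 3; 6] L.
Proof.
have := @pieceP occupied used [::] [::] [:: 3; 3; 6]
    [:: [:: [:: 3; 7; 4]; [:: 9; 12; 11]; [:: 1; 5; 8; 10; 6; 2]]; [:: [:: 2;
    5; 4]; [:: 11; 15; 13]; [:: 6; 9; 8; 12; 10; 7]]; [:: [:: 7; 11; 8]; [::
    9; 13; 10]; [:: 0; 4; 6; 5; 3; 2]]; [:: [:: 5; 9; 7]; [:: 10; 14; 11];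
    [:: 0; 3; 6; 8; 4; 1]]] erefl.
by eexists; eassumption.
Qed.

Lemma piece_3_3_7 : exists L,
  piece occupied used [::] [::] [:: 3; 3; 7] L.
Proof.
have := @pieceP occupied used [::] [::] [:: 3; 3; 7]
    [:: [:: [:: 3; 7; 4]; [:: 10; 13; 12]; [:: 1; 5; 9; 11; 8; 6; 2]]; [::
    [:: 2; 5; 4]; [:: 12; 16; 14]; [:: 6; 10; 8; 7; 11; 13; 9]]; [:: [:: 8;
    12; 9]; [:: 10; 14; 11]; [:: 0; 4; 6; 7; 5; 3; 2]]; [:: [:: 7; 10; 9];
    [:: 11; 15; 12]; [:: 0; 3; 6; 5; 8; 4; 1]]] erefl.
by eexists; eassumption.
Qed.

Lemma piece_4_6 : exists L,
  piece occupied used [::] [::] [:: 4; 6] L.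
Proof.
have := @pieceP occupied used [::] [::] [:: 4; 6]
    [:: [:: [:: 7; 10; 9; 8]; [:: 1; 5; 4; 3; 6; 2]]; [:: [:: 7; 11; 13; 9];
    [:: 2; 5; 6; 10; 8; 4]]; [:: [:: 5; 9; 11; 8]; [:: 0; 4; 6; 7; 3; 2]];
    [:: [:: 6; 9; 12; 8]; [:: 0; 3; 5; 7; 4; 1]]] erefl.
by eexists; eassumption.
Qed.

Lemma piece_3_4_5 : exists L,
  piece occupied used [::] [::] [:: 3; 4; 5] L.
Proof.
have := @pieceP occupied used [::] [::] [:: 3; 4; 5]
    [:: [:: [:: 9; 12; 11]; [:: 1; 5; 6; 2]; [:: 3; 7; 10; 8; 4]]; [:: [::
    11; 15; 13]; [:: 6; 10; 12; 8]; [:: 2; 5; 9; 7; 4]]; [:: [:: 9; 13; 10];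
    [:: 5; 8; 11; 7]; [:: 0; 4; 6; 3; 2]]; [:: [:: 10; 14; 11]; [:: 6; 9; 8;
    7]; [:: 0; 3; 5; 4; 1]]] erefl.
by eexists; eassumption.
Qed.

Lemma piece_3_4_6 : exists L,
  piece occupied used [::] [::] [:: 3; 4; 6] L.
Proof.
have := @pieceP occupied used [::] [::] [:: 3; 4; 6]
    [:: [:: [:: 3; 7; 4]; [:: 9; 13; 11; 12]; [:: 1; 5; 8; 10; 6; 2]]; [::
    [:: 2; 5; 4]; [:: 6; 9; 8; 7]; [:: 10; 13; 12; 16; 14; 11]]; [:: [:: 10;
    14; 12]; [:: 5; 9; 11; 7]; [:: 0; 4; 8; 6; 3; 2]]; [:: [:: 7; 10; 9]; [::
    8; 12; 15; 11]; [:: 0; 3; 5; 6; 4; 1]]] erefl.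
by eexists; eassumption.
Qed.

Lemma piece_3_4_4 : exists L,
  piece occupied used [::] [::] [:: 3; 4; 4] L.
Proof.
have := @pieceP occupied used [::] [::] [:: 3; 4; 4]
    [:: [:: [:: 8; 11; 10]; [:: 1; 5; 3; 2]; [:: 4; 7; 9; 6]]; [:: [:: 10;
    14; 12]; [:: 2; 6; 8; 4]; [:: 5; 9; 11; 7]]; [:: [:: 8; 12; 9]; [:: 0; 4;
    5; 2]; [:: 3; 7; 10; 6]]; [:: [:: 9; 13; 10]; [:: 0; 3; 4; 1]; [:: 5; 8;
    7; 6]]] erefl.
by eexists; eassumption.
Qed.

Lemma piece_3_3_4_4 : exists L,
  piece occupied used [::] [::] [:: 3; 3; 4; 4] L.
Proof.
have := @pieceP occupied used [::] [::] [:: 3; 3; 4; 4]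
    [:: [:: [:: 4; 8; 7]; [:: 6; 10; 9]; [:: 1; 5; 3; 2]; [:: 11; 14; 13;
    12]]; [:: [:: 2; 6; 4]; [:: 5; 9; 7]; [:: 8; 12; 14; 10]; [:: 11; 15; 17;
    13]]; [:: [:: 3; 7; 6]; [:: 8; 11; 9]; [:: 0; 4; 5; 2]; [:: 10; 13; 15;
    12]]; [:: [:: 5; 8; 6]; [:: 7; 11; 10]; [:: 0; 3; 4; 1]; [:: 9; 13; 16;
    12]]] erefl.
by eexists; eassumption.
Qed.

(** Centred at 3, the exchange gives up the strip edges (3,6), (0,3), (1,5) for additional copies of
    (3,5), (1,3) and the longer edge (0,6). *)
Lemma piece_4_5 : exists L,
  piece occupied used (central_star 3 2 3) (central_star 2 3 3) [:: 4; 5] L.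
Proof.
have := @pieceP occupied used (central_star 3 2 3) (central_star 2 3 3) [:: 4; 5]
    [:: [:: [:: 6; 8; 9; 7]; [:: 1; 3; 5; 4; 2]]; [:: [:: 2; 6; 9; 5]; [:: 4;
    8; 12; 10; 7]]; [:: [:: 0; 4; 3; 2]; [:: 5; 7; 8; 10; 6]]; [:: [:: 0; 6;
    4; 1]; [:: 3; 7; 11; 8; 5]]] erefl.
by eexists; eassumption.
Qed.

Lemma piece_3_3_4 : exists L,
  piece occupied used (central_star 3 2 5) (central_star 2 3 5) [:: 3; 3; 4] L.
Proof.
have := @pieceP occupied used (central_star 3 2 5) (central_star 2 3 5) [:: 3; 3; 4]
    [:: [:: [:: 4; 8; 6]; [:: 7; 10; 9]; [:: 1; 5; 3; 2]]; [:: [:: 4; 7; 5];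
    [:: 9; 13; 11]; [:: 2; 8; 10; 6]]; [:: [:: 0; 4; 2]; [:: 7; 11; 8]; [::
    3; 6; 9; 5]]; [:: [:: 5; 7; 6]; [:: 8; 12; 9]; [:: 0; 3; 4; 1]]] erefl.
by eexists; eassumption.
Qed.

Lemma piece_3_3_3_4 : exists L,
  piece occupied used (central_star 3 2 5) (central_star 2 3 5) [:: 3; 3; 3; 4] L.
Proof.
have := @pieceP occupied used (central_star 3 2 5) (central_star 2 3 5) [:: 3; 3; 3; 4]
    [:: [:: [:: 1; 4; 2]; [:: 7; 11; 8]; [:: 10; 13; 12]; [:: 3; 6; 9; 5]];
    [:: [:: 4; 7; 5]; [:: 9; 13; 11]; [:: 12; 16; 14]; [:: 2; 8; 10; 6]]; [::
    [:: 5; 7; 6]; [:: 8; 12; 9]; [:: 10; 14; 11]; [:: 0; 4; 3; 2]]; [:: [::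
    4; 8; 6]; [:: 7; 10; 9]; [:: 11; 15; 12]; [:: 0; 3; 5; 1]]] erefl.
by eexists; eassumption.
Qed.

Lemma piece_3_3_3_3_4 : exists L,
  piece occupied used (central_star 3 1 6) (central_star 1 3 6) [:: 3; 3; 3; 3; 4] L.
Proof.
have := @pieceP occupied used (central_star 3 1 6) (central_star 1 3 6) [:: 3; 3; 3; 3; 4]
    [:: [:: [:: 3; 7; 4]; [:: 8; 12; 9]; [:: 10; 14; 11]; [:: 13; 16; 15];
    [:: 1; 5; 6; 2]]; [:: [:: 6; 10; 7]; [:: 9; 13; 11]; [:: 12; 16; 14]; [::
    15; 19; 17]; [:: 2; 5; 8; 4]]; [:: [:: 0; 3; 2]; [:: 4; 6; 5]; [:: 11;
    15; 12]; [:: 13; 17; 14]; [:: 7; 9; 10; 8]]; [:: [:: 0; 4; 1]; [:: 3; 9;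
    5]; [:: 10; 13; 12]; [:: 14; 18; 15]; [:: 6; 8; 11; 7]]] erefl.
by eexists; eassumption.
Qed.

Lemma piece_3_4_4_4 : exists L,
  piece occupied used (central_star 3 2 3) (central_star 2 3 3) [:: 3; 4; 4; 4] L.
Proof.
have := @pieceP occupied used (central_star 3 2 3) (central_star 2 3 3) [:: 3; 4; 4; 4]
    [:: [:: [:: 1; 3; 2]; [:: 4; 6; 9; 5]; [:: 7; 10; 11; 8]; [:: 12; 15; 14;
    13]]; [:: [:: 6; 10; 8]; [:: 2; 5; 7; 4]; [:: 9; 13; 15; 11]; [:: 12; 16;
    18; 14]]; [:: [:: 0; 6; 2]; [:: 3; 5; 8; 4]; [:: 7; 11; 12; 9]; [:: 10;
    14; 16; 13]]; [:: [:: 0; 4; 1]; [:: 3; 7; 6; 5]; [:: 8; 12; 10; 9]; [::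
    11; 14; 17; 13]]] erefl.
by eexists; eassumption.
Qed.

(** * Long cycles from growing open paths *)

Lemma path_pairs_cat (T : Type) (x : T) s s' :
  path_pairs ((x :: s) ++ s') = path_pairs (x :: s) ++ path_pairs (last x s :: s').
Proof.
by elim: s x => [|y s IH] x; rewrite //= -IH.
Qed.

Lemma path_pairs_rcons_cat (T : Type) (x : T) s s' :
  path_pairs (s ++ x :: s') = path_pairs (rcons s x) ++ path_pairs (x :: s').
Proof.
case: s => [|y s]; first by [].
by rewrite rcons_cons -cat_rcons -rcons_cons path_pairs_cat last_rcons.
Qed.

Lemma cycle_pairs_path (T : Type) (x : T) s :
  cycle_pairs (x :: s) = path_pairs (x :: rcons s x).
Proof.
rewrite /cycle_pairs /path_pairs rot1_cons /=.
by elim: (s) {1 3}x => [|z s' IH] y //=; rewrite IH.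
Qed.

Lemma path_pairs_map (T U : Type) (f : T -> U) s :
  path_pairs (map f s) = [seq (f x.1, f x.2) | x <- path_pairs s].
Proof.
rewrite /path_pairs behead_map.
by elim: s (behead s) => [|x s IH] [|y s'] //=; rewrite IH.
Qed.

Lemma path_seq_shift n s :
  path_seq (map (addn n) s) = map (shift_pair n) (path_seq s).
Proof.
rewrite /path_seq path_pairs_map -!map_comp; apply: eq_map => x /=.
exact: ordered_pair_shift.
Qed.

(* In each copy of an open piece a last cycle is still an open path, whose two
   ends lie at offsets [low_end] and [high_end] from the front [f]; [touched]
   are the vertices beyond the front already covered. *)
Definition low_end t := nth 0 [:: 1; 0; 1; 0] t.
Definition high_end t := nth 0 [:: 3; 1; 2; 2] t.
Definition touched t :=
  nth [::] [:: [:: 1; 3]; [:: 0; 1]; [:: 0; 1; 2]; [:: 0; 2]] t.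

(** Offsets from the front: [grow_low] is prepended and [grow_high] appended when the front advances
    by 4, while [cap] joins the high end back to the low end, advances by 3 and restores the
    frontier [occupied], [used]. *)
Definition grow_low t := nth [::] [:: [:: 5; 2; 0]; [:: 4]; [:: 5]; [:: 4; 1; 3]] t.
Definition grow_high t := nth [::] [:: [:: 7]; [:: 2; 3; 5]; [:: 4; 3; 6]; [:: 6]] t.
Definition cap t := nth [::] [:: [:: 0; 2]; [:: 3; 2; 6; 4]; [:: 4]; [:: 5; 1]] t.

Definition open_piece (f : nat) (pre : seq nat)
    (cs : nat -> seq (seq nat)) (pa : nat -> seq nat) : Prop :=
  [/\ forall t, t < 4 -> shape (cs t) = pre,
      forall t, t < 4 -> exists2 s, pa t = f + low_end t :: s
                                  & last (f + low_end t) s = f + high_end t,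
      forall t, t < 4 -> forall w : nat -> nat,
        \sum_(x <- occupied t) w x + \sum_(x <- flatten (cs t)) w x
          + \sum_(x <- pa t) w x
        = \sum_(x <- iota 0 f) w x + \sum_(x <- touched t) w (f + x)
    & forall w : nat * nat -> nat,
        \sum_(x <- used) w x
          + \sum_(0 <= t < 4) (\sum_(x <- edge_seq (cs t)) w x
                               + \sum_(x <- path_seq (pa t)) w x)
        = \sum_(x <- strip f) w x].

Definition open_check (f : nat) (pre : seq nat)
    (cs : seq (seq (seq nat))) (pa : seq (seq nat)) : bool :=
  [&& all (fun t => shape (nth [::] cs t) == pre) (iota 0 4),
      all (fun t => if nth [::] pa t is x :: s
                    then (x == f + low_end t) && (last x s == f + high_end t)
                    else false) (iota 0 4),
      all (fun t => perm_eq
             (occupied t ++ flatten (nth [::] cs t) ++ nth [::] pa t)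
             (iota 0 f ++ map (addn f) (touched t))) (iota 0 4)
    & perm_eq (used ++ flatten [seq edge_seq (nth [::] cs t)
                                    ++ path_seq (nth [::] pa t) | t <- iota 0 4])
        (strip f)].

Lemma open_pieceP f pre cs pa :
  open_check f pre cs pa -> open_piece f pre (nth [::] cs) (nth [::] pa).
Proof.
have lt4 t : t < 4 -> t \in iota 0 4 by rewrite mem_iota.
case/and4P => /allP sh /allP ends /allP vs es; split.
- by move=> t /lt4/sh/eqP.
- move=> t /lt4/ends; case: (nth _ _ _) => // x s /andP[/eqP-> /eqP lE].
  by exists s.
- move=> t /lt4/vs E w; rewrite -addnA.
  transitivity (\sum_(x <- occupied t ++ flatten (nth [::] cs t)
                            ++ nth [::] pa t) w x); first by rewrite !big_cat.
  by rewrite (perm_big _ E) big_cat big_map.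
move=> w; rewrite -(perm_big _ es) big_cat big_flatten big_map; congr (_ + _).
by apply: eq_bigr => t _; rewrite big_cat.
Qed.

(** Growth keeps the front fixed modulo 4, hence one start per residue class. *)
Lemma open_start i : i < 4 -> exists cs pa, open_piece (4 + i) [::] cs pa.
Proof.
case: i => [|[|[|[|//]]]] _; do 2 eexists.
- apply: (@open_pieceP 4 [::]
      [:: [::]; [::]; [::]; [::]]
      [:: [:: 5; 1; 2; 3; 7]; [:: 4; 2; 5]; [:: 5; 3; 4; 0; 2; 6]; [:: 4; 1;
      0; 3; 6]] erefl).
- apply: (@open_pieceP 5 [::]
      [:: [::]; [::]; [::]; [::]]
      [:: [:: 6; 3; 2; 1; 4; 8]; [:: 5; 2; 4; 6]; [:: 6; 2; 0; 4; 5; 3; 7];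
      [:: 5; 1; 0; 3; 4; 7]] erefl).
- apply: (@open_pieceP 6 [::]
      [:: [::]; [::]; [::]; [::]]
      [:: [:: 7; 3; 4; 2; 1; 5; 9]; [:: 6; 2; 5; 4; 7]; [:: 7; 5; 6; 3; 2; 0;
      4; 8]; [:: 6; 4; 1; 0; 3; 5; 8]] erefl).
- apply: (@open_pieceP 7 [::]
      [:: [::]; [::]; [::]; [::]]
      [:: [:: 8; 5; 1; 2; 4; 3; 6; 10]; [:: 7; 5; 2; 6; 4; 8]; [:: 8; 6; 7;
      3; 2; 0; 4; 5; 9]; [:: 7; 4; 1; 0; 3; 5; 6; 9]] erefl).
Qed.

Lemma open_start_3 i : i < 4 -> exists cs pa, open_piece (7 + i) [:: 3] cs pa.
Proof.
case: i => [|[|[|[|//]]]] _; do 2 eexists.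
- apply: (@open_pieceP 7 [:: 3]
      [:: [:: [:: 1; 5; 2]]; [:: [:: 2; 6; 4]]; [:: [:: 0; 3; 2]]; [:: [:: 0;
      4; 1]]]
      [:: [:: 8; 4; 3; 6; 10]; [:: 7; 5; 8]; [:: 8; 6; 7; 4; 5; 9]; [:: 7; 3;
      5; 6; 9]] erefl).
- apply: (@open_pieceP 8 [:: 3]
      [:: [:: [:: 1; 5; 2]]; [:: [:: 2; 6; 4]]; [:: [:: 0; 3; 2]]; [:: [:: 0;
      4; 1]]]
      [:: [:: 9; 6; 3; 4; 7; 11]; [:: 8; 5; 7; 9]; [:: 9; 5; 4; 8; 7; 6; 10];
      [:: 8; 6; 5; 3; 7; 10]] erefl).
- apply: (@open_pieceP 9 [:: 3]
      [:: [:: [:: 1; 5; 2]]; [:: [:: 2; 6; 4]]; [:: [:: 0; 3; 2]]; [:: [:: 0;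
      4; 1]]]
      [:: [:: 10; 7; 6; 3; 4; 8; 12]; [:: 9; 7; 5; 8; 10]; [:: 10; 6; 9; 5;
      4; 7; 8; 11]; [:: 9; 8; 6; 5; 3; 7; 11]] erefl).
- apply: (@open_pieceP 10 [:: 3]
      [:: [:: [:: 1; 5; 2]]; [:: [:: 5; 9; 8]]; [:: [:: 0; 3; 2]]; [:: [:: 0;
      4; 1]]]
      [:: [:: 11; 8; 4; 3; 6; 7; 9; 13]; [:: 10; 6; 2; 4; 7; 11]; [:: 11; 9;
      10; 7; 5; 4; 6; 8; 12]; [:: 10; 8; 7; 3; 5; 6; 9; 12]] erefl).
Qed.

Lemma open_start_3_3 i : i < 4 -> exists cs pa, open_piece (11 + i) [:: 3; 3] cs pa.
Proof.
case: i => [|[|[|[|//]]]] _; do 2 eexists.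
- apply: (@open_pieceP 11 [:: 3; 3]
      [:: [:: [:: 1; 5; 2]; [:: 3; 7; 4]]; [:: [:: 2; 6; 4]; [:: 5; 9; 7]];
      [:: [:: 0; 3; 2]; [:: 4; 8; 5]]; [:: [:: 0; 4; 1]; [:: 3; 6; 5]]]
      [:: [:: 12; 8; 6; 9; 10; 14]; [:: 11; 8; 10; 12]; [:: 12; 9; 11; 7; 6;
      10; 13]; [:: 11; 10; 7; 8; 9; 13]] erefl).
- apply: (@open_pieceP 12 [:: 3; 3]
      [:: [:: [:: 1; 5; 2]; [:: 3; 7; 4]]; [:: [:: 2; 6; 4]; [:: 5; 9; 7]];
      [:: [:: 0; 3; 2]; [:: 4; 8; 5]]; [:: [:: 0; 4; 1]; [:: 3; 6; 5]]]
      [:: [:: 13; 10; 9; 6; 8; 11; 15]; [:: 12; 8; 10; 11; 13]; [:: 13; 9;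
      12; 10; 6; 7; 11; 14]; [:: 12; 11; 9; 8; 7; 10; 14]] erefl).
- apply: (@open_pieceP 13 [:: 3; 3]
      [:: [:: [:: 1; 5; 2]; [:: 3; 7; 4]]; [:: [:: 2; 6; 4]; [:: 5; 9; 7]];
      [:: [:: 0; 3; 2]; [:: 4; 8; 5]]; [:: [:: 0; 4; 1]; [:: 3; 6; 5]]]
      [:: [:: 14; 11; 10; 9; 6; 8; 12; 16]; [:: 13; 10; 8; 11; 12; 14]; [::
      14; 10; 6; 7; 11; 13; 9; 12; 15]; [:: 13; 12; 10; 7; 8; 9; 11; 15]] erefl).
- apply: (@open_pieceP 14 [:: 3; 3]
      [:: [:: [:: 1; 5; 2]; [:: 3; 7; 4]]; [:: [:: 2; 6; 4]; [:: 5; 9; 7]];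
      [:: [:: 0; 3; 2]; [:: 4; 8; 5]]; [:: [:: 0; 4; 1]; [:: 3; 6; 5]]]
      [:: [:: 15; 12; 11; 10; 6; 8; 9; 13; 17]; [:: 14; 10; 12; 8; 11; 13;
      15]; [:: 15; 11; 9; 6; 7; 10; 13; 14; 12; 16]; [:: 14; 11; 7; 8; 10; 9;
      12; 13; 16]] erefl).
Qed.

Lemma open_start_4 i : i < 4 -> exists cs pa, open_piece (8 + i) [:: 4] cs pa.
Proof.
case: i => [|[|[|[|//]]]] _; do 2 eexists.
- apply: (@open_pieceP 8 [:: 4]
      [:: [:: [:: 1; 4; 3; 2]]; [:: [:: 2; 6; 7; 4]]; [:: [:: 0; 3; 5; 2]];
      [:: [:: 0; 4; 5; 1]]]
      [:: [:: 9; 6; 5; 7; 11]; [:: 8; 5; 9]; [:: 9; 7; 8; 4; 6; 10]; [:: 8;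
      6; 3; 7; 10]] erefl).
- apply: (@open_pieceP 9 [:: 4]
      [:: [:: [:: 1; 5; 3; 2]]; [:: [:: 2; 6; 8; 4]]; [:: [:: 0; 4; 5; 2]];
      [:: [:: 0; 3; 4; 1]]]
      [:: [:: 10; 6; 4; 7; 8; 12]; [:: 9; 5; 7; 10]; [:: 10; 8; 9; 6; 3; 7;
      11]; [:: 9; 7; 6; 5; 8; 11]] erefl).
- apply: (@open_pieceP 10 [:: 4]
      [:: [:: [:: 1; 5; 3; 2]]; [:: [:: 2; 6; 7; 4]]; [:: [:: 0; 4; 5; 2]];
      [:: [:: 0; 3; 4; 1]]]
      [:: [:: 11; 7; 8; 4; 6; 9; 13]; [:: 10; 9; 5; 8; 11]; [:: 11; 9; 7; 3;
      6; 10; 8; 12]; [:: 10; 7; 5; 6; 8; 9; 12]] erefl).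
- apply: (@open_pieceP 11 [:: 4]
      [:: [:: [:: 1; 4; 3; 2]]; [:: [:: 2; 5; 6; 4]]; [:: [:: 4; 8; 11; 7]];
      [:: [:: 0; 4; 5; 1]]]
      [:: [:: 12; 9; 6; 7; 5; 8; 10; 14]; [:: 11; 10; 9; 7; 8; 12]; [:: 12;
      10; 6; 2; 0; 3; 5; 9; 13]; [:: 11; 9; 8; 6; 3; 7; 10; 13]] erefl).
Qed.

Lemma open_start_3_4 i : i < 4 -> exists cs pa, open_piece (11 + i) [:: 3; 4] cs pa.
Proof.
case: i => [|[|[|[|//]]]] _; do 2 eexists.
- apply: (@open_pieceP 11 [:: 3; 4]
      [:: [:: [:: 1; 5; 2]; [:: 3; 6; 7; 4]]; [:: [:: 2; 6; 4]; [:: 5; 9; 10;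
      7]]; [:: [:: 0; 3; 2]; [:: 4; 8; 6; 5]]; [:: [:: 0; 4; 1]; [:: 3; 7; 8;
      5]]]
      [:: [:: 12; 9; 8; 10; 14]; [:: 11; 8; 12]; [:: 12; 10; 11; 7; 9; 13];
      [:: 11; 9; 6; 10; 13]] erefl).
- apply: (@open_pieceP 12 [:: 3; 4]
      [:: [:: [:: 1; 5; 2]; [:: 3; 7; 8; 4]]; [:: [:: 2; 6; 4]; [:: 5; 9; 10;
      7]]; [:: [:: 0; 3; 2]; [:: 4; 7; 6; 5]]; [:: [:: 0; 4; 1]; [:: 3; 6; 8;
      5]]]
      [:: [:: 13; 10; 6; 9; 11; 15]; [:: 12; 8; 11; 13]; [:: 13; 9; 8; 10;
      12; 11; 14]; [:: 12; 9; 7; 11; 10; 14]] erefl).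
- apply: (@open_pieceP 13 [:: 3; 4]
      [:: [:: [:: 1; 5; 2]; [:: 3; 7; 8; 4]]; [:: [:: 2; 6; 4]; [:: 5; 9; 11;
      7]]; [:: [:: 0; 3; 2]; [:: 4; 7; 6; 5]]; [:: [:: 0; 4; 1]; [:: 3; 6; 8;
      5]]]
      [:: [:: 14; 11; 10; 6; 9; 12; 16]; [:: 13; 10; 8; 12; 14]; [:: 14; 10;
      9; 8; 11; 13; 12; 15]; [:: 13; 9; 7; 10; 12; 11; 15]] erefl).
- apply: (@open_pieceP 14 [:: 3; 4]
      [:: [:: [:: 1; 5; 2]; [:: 3; 7; 8; 4]]; [:: [:: 2; 6; 4]; [:: 5; 9; 11;
      7]]; [:: [:: 0; 3; 2]; [:: 4; 7; 6; 5]]; [:: [:: 0; 4; 1]; [:: 3; 6; 8;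
      5]]]
      [:: [:: 15; 11; 12; 10; 6; 9; 13; 17]; [:: 14; 13; 10; 8; 12; 15]; [::
      15; 13; 11; 8; 9; 10; 14; 12; 16]; [:: 14; 11; 10; 7; 9; 12; 13; 16]] erefl).
Qed.


Lemma sum_grow f t (w : nat -> nat) : t < 4 ->
  \sum_(x <- touched t) w (f + x) + \sum_(x <- grow_low t) w (f + x)
    + \sum_(x <- grow_high t) w (f + x)
  = \sum_(x <- iota 0 4) w (f + x) + \sum_(x <- touched t) w (f + 4 + x).
Proof.
move=> t4; have /allP/(_ t) : all (fun t =>
    perm_eq (touched t ++ grow_low t ++ grow_high t)
            (iota 0 4 ++ map (addn 4) (touched t))) (iota 0 4) by [].
rewrite mem_iota => /(_ t4) E; rewrite -addnA.
transitivity (\sum_(x <- touched t ++ grow_low t ++ grow_high t) w (f + x)).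
  by rewrite !big_cat.
rewrite (perm_big _ E) big_cat big_map; congr (_ + _).
by apply: eq_bigr => x _; rewrite addnA.
Qed.

Lemma sum_path_extend f x y low high s (w : nat * nat -> nat) :
  last (f + x) s = f + y ->
  \sum_(e <- path_seq (map (addn f) low ++ (f + x :: s) ++ map (addn f) high)) w e
  = \sum_(e <- path_seq (f + x :: s)) w e
    + \sum_(e <- path_seq (rcons low x) ++ path_seq (y :: high))
        w (shift_pair f e).
Proof.
move=> sl; rewrite /path_seq path_pairs_rcons_cat -cat_cons path_pairs_cat sl.
rewrite -map_rcons -[f + y :: _]/(map (addn f) (y :: high)) !map_cat !big_cat.
by rewrite -!/(path_seq _) !path_seq_shift !big_map addnCA.
Qed.

(** The edges added in the four copies are exactly the sixteen strip edges with lower end among the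
    next four vertices, so growing leaves no edge debt. *)
Lemma sum_grow_edges f (w : nat * nat -> nat) :
  \sum_(0 <= t < 4) \sum_(e <- path_seq (rcons (grow_low t) (low_end t))
                               ++ path_seq (high_end t :: grow_high t))
      w (shift_pair f e)
  = \sum_(e <- strip 4) w (shift_pair f e).
Proof.
have E : perm_eq (flatten
    [seq path_seq (rcons (grow_low t) (low_end t))
         ++ path_seq (high_end t :: grow_high t) | t <- iota 0 4]) (strip 4) by [].
by rewrite -(perm_big _ E) big_flatten big_map.
Qed.

Lemma sum_cap f t (w : nat -> nat) : t < 4 ->
  \sum_(x <- touched t) w (f + x) + \sum_(x <- cap t) w (f + x)
  = \sum_(x <- iota 0 3) w (f + x) + \sum_(x <- occupied t) w (f + 3 + x).
Proof.
move=> t4; have /allP/(_ t) : all (fun t => perm_eq (touched t ++ cap t)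
            (iota 0 3 ++ map (addn 3) (occupied t))) (iota 0 4) by [].
rewrite mem_iota => /(_ t4) E.
transitivity (\sum_(x <- touched t ++ cap t) w (f + x)); first by rewrite big_cat.
rewrite (perm_big _ E) big_cat big_map; congr (_ + _).
by apply: eq_bigr => x _; rewrite addnA.
Qed.

Lemma sum_cap_edges f (w : nat * nat -> nat) :
  \sum_(0 <= t < 4) \sum_(e <- path_seq (high_end t :: rcons (cap t) (low_end t)))
      w (shift_pair f e)
  = \sum_(e <- strip 3) w (shift_pair f e)
    + \sum_(e <- used) w (shift_pair (f + 3) e).
Proof.
have E : perm_eq (flatten
    [seq path_seq (high_end t :: rcons (cap t) (low_end t)) | t <- iota 0 4])
    (strip 3 ++ map (shift_pair 3) used) by [].
transitivity (\sum_(e <- strip 3 ++ map (shift_pair 3) used) w (shift_pair f e)).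
  by rewrite -(perm_big _ E) big_flatten big_map.
rewrite big_cat big_map; congr (_ + _); apply: eq_bigr => x _.
by rewrite /shift_pair /= !addnA.
Qed.

Lemma open_piece_grow f pre cs pa : open_piece f pre cs pa ->
  open_piece (f + 4) pre cs
    (fun t => map (addn f) (grow_low t) ++ pa t ++ map (addn f) (grow_high t)).
Proof.
move=> [sh ends vs es]; split=> //.
- case=> [|[|[|[|//]]]] t4; have [s -> sl] := ends _ t4; rewrite /= -!addnA;
    eexists; try reflexivity; by rewrite /= ?last_cat /= ?last_cat /= ?addnA.
- move=> t t4 w; rewrite !big_cat /= !big_map sum_iota_add.
  by have := vs t t4 w; have := sum_grow f w t4; lia.
move=> w; rewrite sum_strip_add -(es w) -addnA -(sum_grow_edges f w).
rewrite -big_split /=; congr (_ + _); apply: eq_big_nat => t /andP[_ t4].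
have [s pE sl] := ends _ t4; rewrite -addnA; congr (_ + _).
by rewrite pE (sum_path_extend _ _ _ sl).
Qed.

Lemma open_piece_iter f pre cs pa r : open_piece f pre cs pa ->
  exists pa', open_piece (f + r * 4) pre cs pa'.
Proof.
move=> op; elim: r => [|r [pa' IH]]; first by exists pa; rewrite addn0.
by have := open_piece_grow IH; rewrite -addnA -mulSnr => ?; eexists; eassumption.
Qed.

Lemma open_piece_close f pre cs pa : sumn pre <= f + 3 -> open_piece f pre cs pa ->
  piece occupied used [::] [::] (rcons pre (f + 3 - sumn pre))
    (fun t => rcons (cs t) (pa t ++ map (addn f) (cap t))).
Proof.
move=> le_pre [sh ends vs es].
have sum_ks : sumn (rcons pre (f + 3 - sumn pre)) = f + 3.
  by rewrite sumn_rcons subnKC.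
have vs' t (t4 : t < 4) (w : nat -> nat) :
    \sum_(x <- occupied t) w x
      + \sum_(x <- flatten (rcons (cs t) (pa t ++ map (addn f) (cap t)))) w x
    = \sum_(x <- iota 0 (f + 3)) w x + \sum_(x <- occupied t) w (f + 3 + x).
  rewrite flatten_rcons !big_cat /= big_map sum_iota_add.
  by have := vs t t4 w; have := sum_cap f w t4; lia.
split; rewrite ?sum_ks //.
  move=> t t4; rewrite /shape map_rcons -!/(shape _) sh //; congr rcons.
  (* The constant weight 1 turns the vertex balance into the length of the closed cycle. *)
  have := vs' t t4 (fun=> 1); rewrite !sum1_size size_iota addnC => /addIn.
  by rewrite flatten_rcons size_cat size_flatten sh //; lia.
move=> w; rewrite !big_nil !addn0 sum_strip_add -(es w) -!addnA; congr (_ + _).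
rewrite -sum_cap_edges -big_split /=; apply: eq_big_nat => t /andP[_ t4].
have [s pE sl] := ends _ t4.
rewrite -cats1 edge_seq_cat big_cat -addnA; congr (_ + _).
rewrite /edge_seq /edge_pairs /= cats0 pE cat_cons cycle_pairs_path.
have -> : f + low_end t :: rcons (s ++ map (addn f) (cap t)) (f + low_end t)
    = (f + low_end t :: s) ++ map (addn f) (rcons (cap t) (low_end t)).
  by rewrite map_rcons -rcons_cat.
rewrite path_pairs_cat sl map_cat big_cat; congr (_ + _).
rewrite -[f + high_end t :: _]/(map (addn f) (_ :: _)) -/(path_seq _).
by rewrite path_seq_shift big_map.
Qed.

(** Capping adds 3 to the front, so [q] is what must be gained over the shortest start: its residue
    modulo 4 selects the start, its quotient the number of growth steps. *)
Lemma long_cycle_piece (f0 : nat) (pre : seq nat) :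
  (forall i, i < 4 -> exists cs pa, open_piece (f0 + i) pre cs pa) ->
  forall k, f0 + 3 <= sumn pre + k ->
  exists L, piece occupied used [::] [::] (rcons pre k) L.
Proof.
move=> start k k_ge; pose q := sumn pre + k - (f0 + 3).
have [cs [pa op]] := start (q %% 4) (@ltn_pmod q 4 isT).
have [pa' {}op] := open_piece_iter (q %/ 4) op.
have fE : f0 + q %% 4 + q %/ 4 * 4 + 3 = sumn pre + k.
  by have := divn_eq q 4; rewrite /q in k_ge *; lia.
have := open_piece_close _ op; rewrite fE addKn => cl.
by eexists; apply: cl; rewrite leq_addr.
Qed.

Lemma piece_k k : 4 < k -> exists L, piece occupied used [::] [::] [:: k] L.
Proof.
move=> k5; have [/eqP->|k_5] := boolP (k == 5); first exact: piece_5.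
have [/eqP->|k_6] := boolP (k == 6); first exact: piece_6.
by apply: (long_cycle_piece open_start) => /=; lia.
Qed.

Lemma piece_3_k k : 4 < k -> exists L, piece occupied used [::] [::] [:: 3; k] L.
Proof.
move=> k5; have [/eqP->|k_5] := boolP (k == 5); first exact: piece_3_5.
have [/eqP->|k_6] := boolP (k == 6); first exact: piece_3_6.
by apply: (long_cycle_piece open_start_3) => /=; lia.
Qed.

Lemma piece_3_3_k k : 4 < k ->
  exists L, piece occupied used [::] [::] [:: 3; 3; k] L.
Proof.
move=> k5; have [/eqP->|k_5] := boolP (k == 5); first exact: piece_3_3_5.
have [/eqP->|k_6] := boolP (k == 6); first exact: piece_3_3_6.
have [/eqP->|k_7] := boolP (k == 7); first exact: piece_3_3_7.
by apply: (long_cycle_piece open_start_3_3) => /=; lia.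
Qed.

Lemma piece_4_k k : 5 < k -> exists L, piece occupied used [::] [::] [:: 4; k] L.
Proof.
move=> k6; have [/eqP->|k_6] := boolP (k == 6); first exact: piece_4_6.
by apply: (long_cycle_piece open_start_4) => /=; lia.
Qed.

Lemma piece_3_4_k k : 4 < k ->
  exists L, piece occupied used [::] [::] [:: 3; 4; k] L.
Proof.
move=> k5; have [/eqP->|k_5] := boolP (k == 5); first exact: piece_3_4_5.
have [/eqP->|k_6] := boolP (k == 6); first exact: piece_3_4_6.
by apply: (long_cycle_piece open_start_3_4) => /=; lia.
Qed.

(** * Placing all cycle lengths of prime sum *)

Lemma piece_regular a b K : all (fun k => 4 < k) K ->
  exists L, piece occupied used [::] [::] (nseq (3 * a) 3 ++ nseq (2 * b) 4 ++ K) L.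
Proof.
move=> K5; elim: a => [|a [L IH]].
  elim: b => [|b [L IH]].
    elim: K K5 => [_|k K IH /= /andP[k5 /IH[L pL]]].
      by eexists; apply: piece_nil.
    have [L1 p1] := piece_k k5; eexists; exact: piece_cat p1 pL.
  have [L1 p1] := piece_4_4; rewrite mulnS nseqD; eexists; exact: piece_cat p1 IH.
have [L1 p1] := piece_3_3_3; rewrite mulnS nseqD; eexists; exact: piece_cat p1 IH.
Qed.

Definition placeable (ks : seq nat) : Prop :=
  exists B eb x y z L,
    [/\ piece B eb (central_star x y z) (central_star y x z) ks L,
        0 < x < 5, 0 < y < 5, x <= z & y <= z].

Lemma placeable_star x y z ks a b K :
  (exists L, piece occupied used (central_star x y z) (central_star y x z) ks L) ->
  0 < x < 5 -> 0 < y < 5 -> x <= z -> y <= z -> all (fun k => 4 < k) K ->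
  placeable (ks ++ nseq (3 * a) 3 ++ nseq (2 * b) 4 ++ K).
Proof.
move=> [L1 p1] x5 y5 xz yz /(piece_regular a b)[L2 p2].
by exists occupied, used, x, y, z; eexists; split=> //; exact: piece_cat p1 p2.
Qed.

Lemma placeable_plain ks a b K :
  (exists L, piece occupied used [::] [::] ks L) -> all (fun k => 4 < k) K ->
  placeable (ks ++ nseq (3 * a) 3 ++ nseq (2 * b) 4 ++ K).
Proof.
move=> [L /piece_trivial_star pL] K5.
by apply: (@placeable_star 1 1 1) => //; exists L.
Qed.

(** This piece is closed up on itself modulo 7 and is never concatenated, so it may have a frontier
    of its own; hence [placeable] leaves [B] and [eb] free. *)
Lemma placeable_3_4 : placeable [:: 3; 4].
Proof.
exists (nth [::] [:: [:: 0]; [:: 0; 1; 2]; [:: 0; 3]; [:: 1]]).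
exists [:: (0, 1); (0, 3)], 1, 1, 1; eexists; split=> //.
apply/piece_trivial_star/(@pieceP _ _ _ _ _
  [:: [:: [:: 2; 6; 4]; [:: 1; 5; 7; 3]]; [:: [:: 4; 8; 7]; [:: 3; 6; 9; 5]];
      [:: [:: 6; 10; 7]; [:: 1; 4; 5; 2]]; [:: [:: 5; 8; 6]; [:: 0; 4; 3; 2]]]).
by [].
Qed.

Lemma perm_short_long (ks : seq nat) : all (fun k => 2 < k) ks ->
  exists a b K, all (fun k => 4 < k) K /\
    perm_eq (nseq a 3 ++ nseq b 4 ++ K) ks.
Proof.
elim: ks => [|k ks IH] /=; first by exists 0, 0, [::].
case/andP => k3 /IH[a [b [K [K5 /permP E]]]].
have [/eqP->|k_3] := boolP (k == 3).
  by exists a.+1, b, K; split=> //; apply/permP => P; rewrite /= E.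
have [/eqP->|k_4] := boolP (k == 4).
  exists a, b.+1, K; split=> //; apply/permP => P.
  by rewrite /= -E !count_cat /= count_cat addnCA.
exists a, b, (k :: K); split; first by rewrite /= K5 andbT; lia.
apply/permP => P; rewrite /= -E !count_cat /=.
by rewrite [in LHS](addnCA (count P (nseq b 4))) addnCA.
Qed.

Lemma perm_absorb (ks : seq nat) c d a b K K' :
  perm_eq ks (nseq c 3 ++ nseq d 4 ++ K') ->
  perm_eq (ks ++ nseq a 3 ++ nseq b 4 ++ K)
          (nseq (c + a) 3 ++ nseq (d + b) 4 ++ K' ++ K).
Proof.
move=> /permP E; apply/permP => P; rewrite !count_cat E !count_cat !count_nseq.
rewrite !mulnDr; move: (count P K) (count P K') => x y.
by case: (P 3); case: (P 4); lia.
Qed.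

Lemma prime_sum_placeable ks :
  all (fun k => 2 < k) ks -> prime (sumn ks) -> 4 < sumn ks ->
  exists2 ks', perm_eq ks' ks & placeable ks'.
Proof.
move=> /perm_short_long[a [b [K [K5 perm_ks]]]] p_pr p4.
suff [ks' perm' pl] : exists2 ks', perm_eq ks' (nseq a 3 ++ nseq b 4 ++ K) & placeable ks'.
  by exists ks' => //; apply: perm_trans perm' perm_ks.
have sumE : sumn ks = 3 * a + 4 * b + sumn K.
  by rewrite -(perm_sumn perm_ks) !sumn_cat !sumn_nseq; lia.
have p_odd : odd (sumn ks) by have := even_prime p_pr; lia.
(* Triangles alone would have a total divisible by 3 and above 4. *)
have p_not3 : K = [::] -> b = 0 -> False.
  move=> KE bE; move: p_pr p4; rewrite sumE KE bE /= !addn0.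
  case/primeP => _ /(_ 3); rewrite dvdn_mulr // => /(_ isT) /=; lia.
have aE := divn_eq a 3; have a3 : a %% 3 < 3 by rewrite ltn_pmod.
have bE := divn_eq b 2; have b2 : b %% 2 < 2 by rewrite ltn_pmod.
(* The exceptional piece [sp] takes [c] triangles, [d] four-cycles and [K'], leaving triangles in
   threes and four-cycles in pairs. *)
have absorb sp c d a' b' K' K1 : perm_eq sp (nseq c 3 ++ nseq d 4 ++ K') ->
    a = c + 3 * a' -> b = d + 2 * b' -> K = K' ++ K1 ->
    placeable (sp ++ nseq (3 * a') 3 ++ nseq (2 * b') 4 ++ K1) ->
    exists2 ks', perm_eq ks' (nseq a 3 ++ nseq b 4 ++ K) & placeable ks'.
  move=> sp_perm -> -> -> pl; eexists; last exact: pl.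
  exact: perm_absorb.
have [a0|a1|a2] : [\/ a %% 3 = 0, a %% 3 = 1 | a %% 3 = 2].
  by case: (a %% 3) a3 => [|[|[|]]] // _; [constructor 1|constructor 2|constructor 3].
all: have [b0|b1] : b %% 2 = 0 \/ b %% 2 = 1 by lia.
all: case: K K5 p_not3 perm_ks sumE absorb => [|k K] K5 p_not3 _ sumE absorb.
all: try have b_pos : 0 < b by have := p_not3 erefl; lia.
all: try have /andP[k5 K5'] := K5.
all: rewrite /= in sumE.
- apply: (absorb [::] 0 0 (a %/ 3) (b %/ 2) [::] [::]) => //; try lia.
  by apply: placeable_plain => //; eexists; apply: piece_nil.
- apply: (absorb [::] 0 0 (a %/ 3) (b %/ 2) [::] (k :: K)) => //; try lia.
  by apply: placeable_plain => //; eexists; apply: piece_nil.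
(* Here [a] is at least 3, since otherwise the total [4 * b] would be even. *)
- apply: (absorb [:: 3; 3; 3; 4] 3 1 (a %/ 3).-1 (b %/ 2) [::] [::]) => //; try lia.
  exact: placeable_star piece_3_3_3_4 _ _ _ _ _.
- have [k_5|k_6] : k = 5 \/ 5 < k by lia.
    subst k.
    apply: (absorb [:: 4; 5] 0 1 (a %/ 3) (b %/ 2) [:: 5] K) => //; try lia.
    exact: placeable_star piece_4_5 _ _ _ _ _.
  apply: (absorb [:: 4; k] 0 1 (a %/ 3) (b %/ 2) [:: k] K) => //; try lia.
  exact: placeable_plain (piece_4_k k_6) _.
- apply: (absorb [:: 3; 4; 4] 1 2 (a %/ 3) (b %/ 2).-1 [::] [::]) => //; try lia.
  exact: placeable_plain piece_3_4_4 _.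
- apply: (absorb [:: 3; k] 1 0 (a %/ 3) (b %/ 2) [:: k] K) => //; try lia.
  exact: placeable_plain (piece_3_k k5) _.
- have [a_1|a_4] : a = 1 \/ 4 <= a by lia.
    have [b_1|b_3] : b = 1 \/ 3 <= b by lia.
      (* Total 7, the one case placed outside the common frontier. *)
      by exists [:: 3; 4]; [rewrite a_1 b_1 | apply: placeable_3_4].
    apply: (absorb [:: 3; 4; 4; 4] 1 3 0 (b %/ 2).-1 [::] [::]) => //; try lia.
    exact: placeable_star piece_3_4_4_4 _ _ _ _ _.
  apply: (absorb [:: 3; 3; 3; 3; 4] 4 1 (a %/ 3).-1 (b %/ 2) [::] [::]) => //; try lia.
  exact: placeable_star piece_3_3_3_3_4 _ _ _ _ _.
- apply: (absorb [:: 3; 4; k] 1 1 (a %/ 3) (b %/ 2) [:: k] K) => //; try lia.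
  exact: placeable_plain (piece_3_4_k k5) _.
- apply: (absorb [:: 3; 3; 4; 4] 2 2 (a %/ 3) (b %/ 2).-1 [::] [::]) => //; try lia.
  exact: placeable_plain piece_3_3_4_4 _.
- apply: (absorb [:: 3; 3; k] 2 0 (a %/ 3) (b %/ 2) [:: k] K) => //; try lia.
  exact: placeable_plain (piece_3_3_k k5) _.
- apply: (absorb [:: 3; 3; 4] 2 1 (a %/ 3) (b %/ 2) [::] [::]) => //; try lia.
  exact: placeable_star piece_3_3_4 _ _ _ _ _.
apply: (absorb [:: 3; 3; 4] 2 1 (a %/ 3) (b %/ 2) [::] (k :: K)) => //; try lia.
exact: placeable_star piece_3_3_4 _ _ _ _ _.
Qed.

(** * Order three and the conclusion *)

Lemma factorisation_order3 (F : mgraph) :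
  simple_graph F -> regular 2 F -> graph_order F = 3 ->
  exists P : {set {set edge (complete_mgraph 4 3)}}, factorisation_into F P.
Proof.
move=> simF reg ordF.
have ends_all (A : {set vert F}) : #|A| = 2 -> exists e : edge F, ends e = A.
  move=> cardA; have: A \in [set ends e | e : edge F].
    suff -> : [set ends e | e : edge F] = [set A : {set vert F} | #|A| == 2].
      by rewrite inE cardA.
    (* Three distinct edges fill all three pairs of vertices. *)
    apply/eqP; rewrite eqEcard card_draws card_imset //.
    rewrite (card_edge_regular2 reg) -/(graph_order F) ordF andbT.
    by apply/subsetP => _ /imsetP[e _ ->]; rewrite inE card_ends.
  by case/imsetP => e _ ->; exists e.
pose phi (_ : 'I_4) (v : vert F) : 'I_3 := cast_ord ordF (enum_rank v).
have phi_inj j : injective (phi j) by move=> v w /cast_ord_inj /enum_rank_inj.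
have phi_bij j : bijective (phi j).
  by apply: inj_card_bij (phi_inj j) _; rewrite card_ord -ordF.
apply: (factorisation_of_labellings simF phi_bij) => A cardA.
rewrite -[RHS]card_ord; apply: eq_card => j; rewrite !inE; apply/existsP.
have [phi' phiK Kphi] := phi_bij j.
have [|e eE] := ends_all (phi' @: A); first by rewrite card_imset //; apply: can_inj Kphi.
exists e; rewrite eE -imset_comp; apply/eqP; rewrite -[RHS]imset_id.
by apply: eq_imset => v /=; rewrite Kphi.
Qed.

Theorem theorem32 (p : nat) (F : mgraph) :
  prime p -> odd p ->
  simple_graph F -> regular 2 F -> graph_order F = p ->
  exists P : {set {set edge (complete_mgraph 4 p)}},
    factorisation_into F P.
Proof.
move=> p_pr p_odd simF reg ordF.
have [p3|p_gt4] : p = 3 \/ 4 < p by have := prime_gt1 p_pr; lia.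
  by rewrite p3 in ordF *; apply: factorisation_order3.
have [cs [perm_cs size_cs perm_es]] := two_regular_cycles simF reg.
have sum_cs : sumn (shape cs) = p.
  by rewrite -size_flatten (perm_size perm_cs) -cardE.
have [|||ks perm_ks pl] := @prime_sum_placeable (shape cs); rewrite ?sum_cs //.
  by rewrite /shape all_map.
(* The cycles of [F] are reordered to follow the lengths of the placement. *)
have [cs' perm_cs' shape_cs'] := perm_map_lift perm_ks.
have [B [eb [x [y [z [L [pL x5 y5 xz yz]]]]]]] := pl.
apply: (piece_factorisation p_pr p_gt4 simF ordF (cs := cs') _ _ shape_cs' pL) => //.
  exact: perm_trans (perm_flatten perm_cs') perm_cs.
by apply: perm_trans perm_es; apply/perm_map/perm_flatten/perm_map.
Qed.
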